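(* For $k\ge3$ define $$\tau_k=\begin{cases}7\cdot 2^{2K-3}-\tfrac23\left(4^{K-2}-1\right),& k=2K-1,\\[4pt] 7\cdot 2^{2K-2}-\tfrac13\left(4^{K-1}-1\right),& k=2K.\end{cases}$$ Then for every $k\ge3$ and every $m$ with $0\le m<\tau_k$, $F_k(m)=0$.
   Context: Let $E(q)=\prod_{m\ge1}(1-q^m)$. $PDO(n)$ is the number of partitions of $n$ into odd parts with designated summands (for each distinct part size, exactly one occurrence is designated); $\sum_{n\ge0}PDO(n)q^n=\frac{E(q^4)E(q^6)^2}{E(q)E(q^3)E(q^{12})}$. Define $$\gamma(q)=\frac{E(q)^5E(q^2)^5E(q^6)^5}{E(q^3)^{15}},\quad \xi=\xi(q)=\frac{E(q^2)^5E(q^6)}{E(q)E(q^3)^5},$$ and for $k\ge3$, $\Phi_k=\gamma(q)^{2^k}\left(\sum_{n\ge0}PDO(2^{k+2}n)q^n-\sum_{n\ge0}PDO(2^kn)q^n\right)$. It is known that $\Phi_k$ equals (as a formal power series in $q$) a polynomial in $\xi$ with integer coefficients; $F_k(m)$ denote these coefficients, $\Phi_k=\sum_m F_k(m)\xi^m$. *)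

(* Defs.v *)
From mathcomp Require Import all_boot all_order all_algebra.
Set Implicit Arguments. Unset Strict Implicit. Unset Printing Implicit Defensive.
Import Order.TTheory GRing.Theory Num.Theory.
Local Open Scope ring_scope.

Definition series := nat -> int.

Definition sone : series := fun n => (n == 0%N)%:R.
Definition ssub (f g : series) : series := fun n => f n - g n.
Definition smul (f g : series) : series :=
  fun n => \sum_(i < n.+1) f i * g (n - i)%N.
Definition spow (f : series) (e : nat) : series := iter e (smul f) sone.

(* E(q^a) = prod_{m>=1} (1 - q^(a m)); for a >= 1 its n-th coefficient equals
   the n-th coefficient of the finite product over 1 <= m <= n. *)
Definition etaE (a : nat) : series :=
  fun n => (\prod_(1 <= m < n.+1) (1 - 'X^(a * m)) : {poly int})`_n.

(* 1/E(q^a) = prod_{m>=1} sum_{j>=0} q^(a m j); truncated likewise. *)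
Definition etaEinv (a : nat) : series :=
  fun n => (\prod_(1 <= m < n.+1) \sum_(j < n.+1) 'X^(a * m * j) : {poly int})`_n.

Definition PDOgf : series :=
  smul (smul (etaE 4) (spow (etaE 6) 2))
       (smul (etaEinv 1) (smul (etaEinv 3) (etaEinv 12))).
Definition PDO (n : nat) : int := PDOgf n.

Definition gammaq : series :=
  smul (smul (spow (etaE 1) 5) (spow (etaE 2) 5))
       (smul (spow (etaE 6) 5) (spow (etaEinv 3) 15)).

Definition xiq : series :=
  smul (smul (spow (etaE 2) 5) (etaE 6))
       (smul (etaEinv 1) (spow (etaEinv 3) 5)).

Definition Phi (k : nat) : series :=
  smul (spow gammaq (2 ^ k))
       (ssub (fun n => PDO (2 ^ (k + 2) * n)) (fun n => PDO (2 ^ k * n))).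

Definition poly_in_xi (P : {poly int}) : series :=
  fun n => \sum_(m < size P) P`_m * spow xiq m n.

(* tau_k; the divisions by 3 are exact since 3 | 4^j - 1. *)
Definition tau (k : nat) : nat :=
  if odd k then
    let K := (k.+1)./2 in (7 * 2 ^ (2 * K - 3) - (2 * (4 ^ (K - 2) - 1)) %/ 3)%N
  else
    let K := k./2 in (7 * 2 ^ (2 * K - 2) - (4 ^ (K - 1) - 1) %/ 3)%N.

(* Main.v *)
(* Write V for the substitution q -> q^2 and U for its left inverse, so that the
   series sum_n PDO(2^k n) q^n is U^k D, with D = sum_n PDO(n) q^n.  The modular
   curve of level 12 has genus 0 with a Hauptmodul t that is odd in q, and
     xi (1 + t)^2 = 1 + 3 t,   V xi (1 - t^2) = 1,   s^3 = (1 + 3 t)(1 - 3 t),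
   where gamma = u^5, s = u (1 + t), and s = V s0 with s0 xi = u^2.  These relations
   turn U into "take the even part in t", since t^2 = V (1 - 1/xi).  One finds
   U D = D^2, U^2 D = u (3 - 2 xi) / (9 - 8 xi), and, for k >= 3, that U^k D lies in
   u^2 Z[xi, 1/(9 - 8 xi)] for k odd and in (u^4 / xi) Z[xi, 1/(9 - 8 xi)] for k even:
   these modules are exchanged by U because a function of t of negative degree has an
   even part of negative degree in t^2.  As u^6 = xi^2 (9 - 8 xi), multiplying by
   gamma^(2^k) gives a power of xi times an element of Z[xi, 1/(9 - 8 xi)], and that
   power is xi^(tau k).  The relations at level 12 all follow from the 3-dissection of
   phi(-q) (Jacobi triple product), by taking a norm over the cube roots of unity. *)
Require Import Defs.
From HB Require Import structures.
From mathcomp Require Import all_boot all_order all_algebra all_field.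
From mathcomp Require Import boolp ring zify.
Set Implicit Arguments. Unset Strict Implicit. Unset Printing Implicit Defensive.
Import Order.TTheory GRing.Theory Num.Theory.
Local Open Scope ring_scope.

(** * Formal power series *)

(** A bare function type, so that [fps int] is convertible with [series] and its product with
    [smul]. *)
Definition fps (R : Type) := nat -> R.
HB.instance Definition _ (R : Type) := gen_eqMixin (fps R).
HB.instance Definition _ (R : Type) := gen_choiceMixin (fps R).

Section FpsRing.
Variable R : comNzRingType.
Implicit Types (f g h : fps R) (n N : nat) (p : {poly R}).

Lemma fpsP f g : (forall n, f n = g n) -> f = g.
Proof. exact: funext. Qed.

Definition fps_add f g : fps R := fun n => f n + g n.
Definition fps_opp f : fps R := fun n => - f n.
Definition fps_mul f g : fps R := fun n => \sum_(i < n.+1) f i * g (n - i)%N.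
Definition fps_of_poly p : fps R := fun n => p`_n.
Definition fps_trunc N f : {poly R} := \poly_(i < N) f i.

Fact fps_addA : associative fps_add.
Proof. by move=> f g h; apply: fpsP => n; rewrite /fps_add addrA. Qed.
Fact fps_addC : commutative fps_add.
Proof. by move=> f g; apply: fpsP => n; rewrite /fps_add addrC. Qed.
Fact fps_add0 : left_id (fps_of_poly 0) fps_add.
Proof. by move=> f; apply: fpsP => n; rewrite /fps_add /fps_of_poly coef0 add0r. Qed.
Fact fps_addN : left_inverse (fps_of_poly 0) fps_opp fps_add.
Proof. by move=> f; apply: fpsP => n; rewrite /fps_add /fps_of_poly coef0 addNr. Qed.
HB.instance Definition _ :=
  GRing.isZmodule.Build (fps R) fps_addA fps_addC fps_add0 fps_addN.

(** Coefficient n of a product depends on finitely many coefficients of the factors, so the ring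
    axioms reduce to those of [{poly R}] on truncations. *)
Lemma fps_mul_trunc N f g n :
  (n < N)%N -> fps_mul f g n = (fps_trunc N f * fps_trunc N g)`_n.
Proof.
move=> ltnN; rewrite coefM; apply: eq_bigr => i _; rewrite !coef_poly.
by rewrite !(leq_ltn_trans _ ltnN) ?leq_subr // -ltnS.
Qed.

Fact fps_mulC : commutative fps_mul.
Proof.
by move=> f g; apply: fpsP => n; rewrite !(@fps_mul_trunc n.+1) // mulrC.
Qed.

Lemma eq_coefMl p1 p2 p n :
  (forall i, (i <= n)%N -> p1`_i = p2`_i) -> (p1 * p)`_n = (p2 * p)`_n.
Proof. by move=> e; rewrite !coefM; apply: eq_bigr => i _; rewrite e // -ltnS. Qed.

Fact fps_mulA : associative fps_mul.
Proof.
move=> f g h; apply: fpsP => n; rewrite fps_mulC !(@fps_mul_trunc n.+1) //.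
transitivity (fps_trunc n.+1 g * fps_trunc n.+1 h * fps_trunc n.+1 f)`_n.
  by apply: eq_coefMl => i lein; rewrite coef_poly ltnS lein -fps_mul_trunc.
rewrite mulrC mulrA; apply/esym/eq_coefMl => i lein.
by rewrite coef_poly ltnS lein -fps_mul_trunc.
Qed.

Fact fps_mul1 : left_id (fps_of_poly 1) fps_mul.
Proof.
move=> f; apply: fpsP => n; rewrite (@fps_mul_trunc n.+1) //.
rewrite (@eq_coefMl _ 1) => [|i lein]; first by rewrite mul1r coef_poly ltnSn.
by rewrite coef_poly ltnS lein.
Qed.

Fact fps_mulDl : left_distributive fps_mul fps_add.
Proof.
move=> f g h; apply: fpsP => n; rewrite /fps_add /fps_mul -big_split.
by apply: eq_bigr => i _; rewrite mulrDl.
Qed.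

Fact fps_one_neq0 : fps_of_poly 1 != 0.
Proof.
apply/eqP => /(congr1 (fun f : fps R => f 0%N)).
by rewrite [RHS]coef0 [LHS]coef1 => /eqP; rewrite oner_eq0.
Qed.

HB.instance Definition _ :=
  GRing.Zmodule_isComNzRing.Build (fps R) fps_mulA fps_mulC fps_mul1 fps_mulDl
    fps_one_neq0.

Lemma fpsD f g n : (f + g) n = f n + g n. Proof. by []. Qed.
Lemma fpsN f n : (- f) n = - f n. Proof. by []. Qed.
Lemma fpsB f g n : (f - g) n = f n - g n. Proof. by []. Qed.
Lemma fpsM f g n : (f * g) n = \sum_(i < n.+1) f i * g (n - i)%N.
Proof. by []. Qed.
Lemma fps0 n : (0 : fps R) n = 0. Proof. exact: coef0. Qed.
Lemma fps1 n : (1 : fps R) n = (n == 0%N)%:R.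
Proof. by rewrite -coef1. Qed.
Lemma fps_sum (I : Type) (r : seq I) (P : pred I) (F : I -> fps R) n :
  (\sum_(i <- r | P i) F i) n = \sum_(i <- r | P i) F i n.
Proof. by elim/big_rec2: _ => [|i a f _ <-] //; rewrite fps0. Qed.

Fact fps_of_poly_zmod : zmod_morphism fps_of_poly.
Proof. by move=> p p'; apply: fpsP => n; rewrite /fps_of_poly coefB. Qed.
Fact fps_of_poly_monoid : monoid_morphism fps_of_poly.
Proof. by split=> // p p'; apply: fpsP => n; rewrite /fps_of_poly coefM. Qed.
HB.instance Definition _ :=
  GRing.isZmodMorphism.Build {poly R} (fps R) fps_of_poly fps_of_poly_zmod.
HB.instance Definition _ :=
  GRing.isMonoidMorphism.Build {poly R} (fps R) fps_of_poly fps_of_poly_monoid.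

Definition fps_const f : R := f 0%N.
Fact fps_const_zmod : zmod_morphism fps_const. Proof. by []. Qed.
Fact fps_const_monoid : monoid_morphism fps_const.
Proof. by split=> [|f g]; rewrite /fps_const ?fps1 // fpsM big_ord1. Qed.
HB.instance Definition _ :=
  GRing.isZmodMorphism.Build (fps R) R fps_const fps_const_zmod.
HB.instance Definition _ :=
  GRing.isMonoidMorphism.Build (fps R) R fps_const fps_const_monoid.

Definition fpsX : fps R := fps_of_poly 'X.

Lemma fpsXnE k : fpsX ^+ k = fps_of_poly 'X^k.
Proof. by rewrite rmorphXn. Qed.

Lemma fpsXnM k f n : (fpsX ^+ k * f) n = if (n < k)%N then 0 else f (n - k)%N.
Proof.
rewrite fpsXnE [LHS](@fps_mul_trunc n.+1) // (@eq_coefMl _ 'X^k) => [|i lein].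
  by rewrite coefXnM coef_poly; case: ltnP => // _; rewrite ltnS leq_subr.
by rewrite coef_poly ltnS lein.
Qed.

Lemma fpsX_reg k f g : fpsX ^+ k * f = fpsX ^+ k * g -> f = g.
Proof.
move=> e; apply: fpsP => n; have /(congr1 (fun f : fps R => f (k + n)%N)) := e.
by rewrite !fpsXnM ltnNge leq_addr addKn.
Qed.

End FpsRing.

Section FpsDomain.
Variable R : idomainType.
Implicit Types f g : fps R.

Definition fps_unit : {pred fps R} := fun f => `[< exists g, g * f = 1 >].
Definition fps_inv f : fps R :=
  if pselect (exists g, g * f = 1) is left e then projT1 (cid e) else f.

Fact fps_mulVf : {in fps_unit, left_inverse 1 fps_inv *%R}.
Proof.
by move=> f /asboolP uf; rewrite /fps_inv; case: pselect => // e; case: cid.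
Qed.
Fact fps_unitPl f g : g * f = 1 -> fps_unit f.
Proof. by move=> e; apply/asboolP; exists g. Qed.
Fact fps_inv_out : {in [predC fps_unit], fps_inv =1 id}.
Proof. by move=> f /asboolPn nf; rewrite /fps_inv; case: pselect. Qed.
HB.instance Definition _ :=
  GRing.ComNzRing_hasMulInverse.Build (fps R) fps_mulVf fps_unitPl fps_inv_out.

Lemma fps_neq0P f : f != 0 -> {h : fps R * nat | f = fpsX R ^+ h.2 * h.1 & h.1 0%N != 0}.
Proof.
move=> f0; have ex : exists n, f n != 0.
  apply: contrapT => nex; case/eqP: f0; apply: fpsP => n; rewrite fps0.
  by apply/eqP; apply: contrapT => fn; apply: nex; exists n; apply/negP.
exists ((fun n => f (ex_minn ex + n)%N) : fps R, ex_minn ex) => /=.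
  apply: fpsP => n; rewrite fpsXnM; case: ex_minnP => m fm mmin.
  case: ltnP => [ltnm|lemn]; last by rewrite subnKC.
  by apply/eqP/contraT => /mmin; rewrite leqNgt ltnm.
by case: ex_minnP => m fm _; rewrite addn0.
Qed.

Fact fps_integral f g : f * g = 0 -> (f == 0) || (g == 0).
Proof.
move=> fg0; apply/norP => -[/fps_neq0P[[f1 i] /= ef f10] /fps_neq0P[[g1 j] /= eg g10]].
have: fpsX R ^+ (i + j) * (f1 * g1) = fpsX R ^+ (i + j) * 0.
  by rewrite mulr0 -fg0 ef eg exprD; ring.
move/fpsX_reg/(congr1 (@fps_const R))/eqP; rewrite rmorphM rmorph0 mulf_eq0.
by apply/negP/norP.
Qed.
HB.instance Definition _ :=
  GRing.ComUnitRing_isIntegral.Build (fps R) fps_integral.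

End FpsDomain.

Lemma fpsX_neq0 (R : comNzRingType) : fpsX R != 0.
Proof.
apply/eqP => /(congr1 (fun f : fps R => f 1%N))/eqP.
by rewrite fps0 [X in X == _]coefX oner_eq0.
Qed.

Section FpsMorphisms.
Variable R : comNzRingType.
Implicit Types (f g : fps R) (r : nat).

(* [q |-> q ^ r.+1]; the index is shifted because [q |-> q ^ 0] is not defined. *)
Definition fps_subst r f : fps R :=
  fun n => if (r.+1 %| n)%N then f (n %/ r.+1)%N else 0.

Lemma fps_substE r f N n :
  (n < N)%N -> fps_subst r f n = (fps_trunc N f \Po 'X^(r.+1))`_n.
Proof.
move=> ltnN; rewrite coef_comp_poly_Xn // coef_poly.
by rewrite (leq_ltn_trans (leq_div _ _) ltnN).
Qed.

Fact fps_subst_zmod r : zmod_morphism (fps_subst r).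
Proof.
by move=> f g; apply: fpsP => n; rewrite fpsB /fps_subst; case: ifP; rewrite ?subrr.
Qed.
Fact fps_subst_monoid r : monoid_morphism (fps_subst r).
Proof.
split=> [|f g]; apply: fpsP => n.
  rewrite /fps_subst !fps1; case: n => [|n]; first by rewrite dvdn0 div0n.
  case: ifP => //; case: eqP => // e dvd_rn; have := divnK dvd_rn.
  by rewrite e.
transitivity ((fps_trunc n.+1 f * fps_trunc n.+1 g) \Po 'X^(r.+1))`_n.
  rewrite coef_comp_poly_Xn // /fps_subst; case: ifP => // _.
  by rewrite -fps_mul_trunc // ltnS leq_div.
rewrite rmorphM coefM fpsM; apply: eq_bigr => i _.
by rewrite -!fps_substE // ltnS ?leq_subr // -ltnS.
Qed.
HB.instance Definition _ r :=
  GRing.isZmodMorphism.Build (fps R) (fps R) (fps_subst r) (fps_subst_zmod r).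
HB.instance Definition _ r :=
  GRing.isMonoidMorphism.Build (fps R) (fps R) (fps_subst r) (fps_subst_monoid r).

Lemma fps_subst_inj r : injective (fps_subst r).
Proof.
move=> f g e; apply: fpsP => n; have /(congr1 (fun f : fps R => f (n * r.+1)%N)) := e.
by rewrite /fps_subst dvdn_mull // mulnK.
Qed.

Lemma fps_substX r : fps_subst r (fpsX R) = fpsX R ^+ r.+1.
Proof.
apply: fpsP => n; rewrite fpsXnE /fps_subst /fpsX /fps_of_poly coefX coefXn.
case: (boolP (r.+1 %| n)%N) => [/divnK e|].
  by rewrite -{2}e; congr (_%:R); case: (n %/ _)%N => [|[|m]] //=; nia.
by case: eqP => // ->; rewrite dvdnn.
Qed.

Lemma fps_subst_const r f : fps_subst r f 0%N = f 0%N.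
Proof. by rewrite /fps_subst dvdn0 div0n. Qed.

(** The substitution q -> z q, used for z a cube root of unity (conjugates in a norm) and for z = -1
    (even and odd parts). *)
Definition fps_twist (z : R) f : fps R := fun n => z ^+ n * f n.
Fact fps_twist_zmod z : zmod_morphism (fps_twist z).
Proof. by move=> f g; apply: fpsP => n; rewrite /fps_twist !fpsB mulrBr. Qed.
Fact fps_twist_monoid z : monoid_morphism (fps_twist z).
Proof.
split=> [|f g]; apply: fpsP => n; rewrite /fps_twist.
  by rewrite fps1; case: n => [|n]; rewrite ?mul1r ?mulr0.
rewrite !fpsM big_distrr; apply: eq_bigr => -[i lin] _ /=.
by rewrite -{1}(@subnKC i n) // exprD; ring.
Qed.
HB.instance Definition _ z :=
  GRing.isZmodMorphism.Build (fps R) (fps R) (fps_twist z) (fps_twist_zmod z).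
HB.instance Definition _ z :=
  GRing.isMonoidMorphism.Build (fps R) (fps R) (fps_twist z) (fps_twist_monoid z).

Definition fps_scal (c : R) : fps R := fps_of_poly c%:P.
Fact fps_scal_zmod : zmod_morphism fps_scal.
Proof. by move=> c d; rewrite /fps_scal polyCB rmorphB. Qed.
Fact fps_scal_monoid : monoid_morphism fps_scal.
Proof. by split=> [|c d]; rewrite /fps_scal ?polyCM ?rmorphM ?rmorph1. Qed.
HB.instance Definition _ :=
  GRing.isZmodMorphism.Build R (fps R) fps_scal fps_scal_zmod.
HB.instance Definition _ :=
  GRing.isMonoidMorphism.Build R (fps R) fps_scal fps_scal_monoid.

Lemma fps_scalM c f n : (fps_scal c * f) n = c * f n.
Proof.
rewrite fpsM big_ord_recl subn0 {1}/fps_scal /fps_of_poly coefC eqxx.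
rewrite big1 ?addr0 // => i _.
by rewrite /fps_scal /fps_of_poly coefC mul0r.
Qed.

Lemma fps_twistX z : fps_twist z (fpsX R) = fps_scal z * fpsX R.
Proof.
apply: fpsP => n; rewrite fps_scalM /fps_twist /fpsX /fps_of_poly coefX.
by case: n => [|[|n]]; rewrite ?mulr0 ?expr1.
Qed.

Lemma fps_twist_subst z r f :
  fps_twist z (fps_subst r f) = fps_subst r (fps_twist (z ^+ r.+1) f).
Proof.
apply: fpsP => n; rewrite /fps_twist /fps_subst; case: ifP; rewrite ?mulr0 //.
by move/divnK => {1}<-; rewrite mulnC exprM.
Qed.

Lemma fps_twist_const z f : fps_twist z f 0%N = f 0%N.
Proof. by rewrite /fps_twist expr0 mul1r. Qed.

Lemma fps_twist1 f : fps_twist 1 f = f.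
Proof. by apply: fpsP => n; rewrite /fps_twist expr1n mul1r. Qed.

(** Congruence modulo q^N. Identities of infinite products are proved by comparing finite products
    modulo q^N for every N. *)
Definition fps_eqmod N f g := forall n, (n < N)%N -> f n = g n.

Lemma fps_eqmodP f g : (forall N, fps_eqmod N f g) -> f = g.
Proof. by move=> e; apply: fpsP => n; apply: (e n.+1). Qed.
Lemma fps_eqmod_sym N f g : fps_eqmod N f g -> fps_eqmod N g f.
Proof. by move=> e n /e. Qed.
Lemma fps_eqmod_trans N g f h :
  fps_eqmod N f g -> fps_eqmod N g h -> fps_eqmod N f h.
Proof. by move=> e e' n lt; rewrite e ?e'. Qed.
Lemma fps_eqmod_le N N' f g : (N <= N')%N -> fps_eqmod N' f g -> fps_eqmod N f g.
Proof. by move=> le e n lt; apply: e; apply: leq_trans le. Qed.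
Lemma fps_eqmodD N f f' g g' :
  fps_eqmod N f f' -> fps_eqmod N g g' -> fps_eqmod N (f + g) (f' + g').
Proof. by move=> e e' n lt; rewrite !fpsD e ?e'. Qed.
Lemma fps_eqmodB N f f' g g' :
  fps_eqmod N f f' -> fps_eqmod N g g' -> fps_eqmod N (f - g) (f' - g').
Proof. by move=> e e' n lt; rewrite !fpsB e ?e'. Qed.
Lemma fps_eqmodM N f f' g g' :
  fps_eqmod N f f' -> fps_eqmod N g g' -> fps_eqmod N (f * g) (f' * g').
Proof.
move=> e e' n lt; rewrite !fpsM; apply: eq_bigr => i _.
by rewrite e ?e' //; apply: leq_ltn_trans lt; rewrite ?leq_subr // -ltnS.
Qed.
Lemma fps_eqmodX N k f g : fps_eqmod N f g -> fps_eqmod N (f ^+ k) (g ^+ k).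
Proof. by move=> e; elim: k => // k IH; rewrite !exprS; apply: fps_eqmodM. Qed.
Lemma fps_eqmod_prod N (I : Type) (r : seq I) (P : pred I) (F G : I -> fps R) :
  (forall i, P i -> fps_eqmod N (F i) (G i)) ->
  fps_eqmod N (\prod_(i <- r | P i) F i) (\prod_(i <- r | P i) G i).
Proof.
by move=> e; elim/big_rec2: _ => // i f g Pi; apply: fps_eqmodM; apply: e.
Qed.
Lemma fps_eqmod_sum N (I : Type) (r : seq I) (P : pred I) (F G : I -> fps R) :
  (forall i, P i -> fps_eqmod N (F i) (G i)) ->
  fps_eqmod N (\sum_(i <- r | P i) F i) (\sum_(i <- r | P i) G i).
Proof.
by move=> e; elim/big_rec2: _ => // i f g Pi; apply: fps_eqmodD; apply: e.
Qed.
Lemma fps_eqmodXM N M k f g : (N <= M + k)%N ->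
  fps_eqmod M f g -> fps_eqmod N (fpsX R ^+ k * f) (fpsX R ^+ k * g).
Proof.
move=> le e n lt; rewrite !fpsXnM; case: ltnP => // len; apply: e; lia.
Qed.
Lemma fps_eqmod_subst N r f g :
  fps_eqmod N f g -> fps_eqmod N (fps_subst r f) (fps_subst r g).
Proof.
move=> e n lt; rewrite /fps_subst; case: ifP => // _; apply: e.
exact: leq_ltn_trans (leq_div _ _) lt.
Qed.
Lemma fps_eqmod_twist N z f g :
  fps_eqmod N f g -> fps_eqmod N (fps_twist z f) (fps_twist z g).
Proof. by move=> e n lt; rewrite /fps_twist e. Qed.

End FpsMorphisms.

Arguments fps_eqmod_trans {R N} g {f h}.

Section FpsMap.
Variables (R S : comNzRingType) (phi : {rmorphism R -> S}).
Definition fps_map (f : fps R) : fps S := fun n => phi (f n).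
Fact fps_map_zmod : zmod_morphism fps_map.
Proof. by move=> f g; apply: fpsP => n; rewrite /fps_map !fpsB rmorphB. Qed.
Fact fps_map_monoid : monoid_morphism fps_map.
Proof.
split=> [|f g]; apply: fpsP => n; rewrite /fps_map ?fps1 ?rmorph_nat //.
by rewrite !fpsM rmorph_sum; apply: eq_bigr => i _; rewrite rmorphM.
Qed.
HB.instance Definition _ :=
  GRing.isZmodMorphism.Build (fps R) (fps S) fps_map fps_map_zmod.
HB.instance Definition _ :=
  GRing.isMonoidMorphism.Build (fps R) (fps S) fps_map fps_map_monoid.
Lemma fps_mapX : fps_map (fpsX R) = fpsX S.
Proof.
by apply: fpsP => n; rewrite /fps_map /fpsX /fps_of_poly !coefX rmorph_nat.
Qed.
Lemma fps_map_inj : injective phi -> injective fps_map.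
Proof.
move=> inj f g e; apply: fpsP => n; apply: inj.
exact: (congr1 (fun f : fps S => f n) e).
Qed.
End FpsMap.

(** * Gaussian binomials and the finite Jacobi triple product *)

Section GaussBinomial.
Variable S : comNzRingType.
Variable p : S.

(** Gaussian binomials through the q-Pascal rule, which makes sense in a ring without division. *)
Fixpoint gbin (m k : nat) : S :=
  match m, k with
  | _, 0%N => 1
  | 0%N, _.+1 => 0
  | m'.+1, k'.+1 => gbin m' k' + p ^+ k'.+1 * gbin m' k'.+1
  end.

Lemma gbin0 m : gbin m 0 = 1. Proof. by case: m. Qed.
Lemma gbinS m k : gbin m.+1 k.+1 = gbin m k + p ^+ k.+1 * gbin m k.+1.
Proof. by []. Qed.
Lemma gbin_small m k : (m < k)%N -> gbin m k = 0.
Proof.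
elim: m k => [|m IH] [|k] //= lt; rewrite !IH ?mulr0 ?addr0 //; lia.
Qed.
Lemma gbinS' m k : gbin m.+1 k.+1 = p ^+ (m - k) * gbin m k + gbin m k.+1.
Proof.
elim: m k => [|m IH] [|k].
- by rewrite gbinS subn0 expr0 /= mulr0 mulr1.
- by rewrite gbinS !gbin_small // !mulr0 !addr0.
- have h1 := IH 0%N; have h2 := gbinS m 0%N; rewrite !gbin0 subn0 in h1 h2 *.
  by rewrite gbinS gbin0 {1}h1 h2 !exprS; ring.
case: (ltnP m.+1 k.+1) => [lt|le].
  by rewrite !gbin_small ?mulr0 ?addr0 //; lia.
rewrite gbinS [in LHS]IH [gbin m.+1 k.+1]gbinS.
case: (ltnP m k.+1) => [lt|lt].
  by rewrite ![gbin m k.+1]gbin_small ?[gbin m.+1 k.+2]gbin_small //; ring.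
rewrite {1}[gbin m.+1 k.+2]IH [gbin m.+1 k.+2]gbinS.
have -> : (m - k = (m - k.+1).+1)%N by lia.
have -> : (m.+1 - k.+1 = (m - k.+1).+1)%N by lia.
rewrite !exprS; ring.
Qed.

Lemma gbinn n : gbin n n = 1.
Proof. by elim: n => //= n ->; rewrite gbin_small // mulr0 addr0. Qed.

Lemma gbin_sym k l : gbin (k + l) k = gbin (k + l) l.
Proof.
have [n] := ubnP (k + l); elim: n k l => // n IH [|k] [|l] lt //.
- by rewrite gbin0 add0n gbinn.
- by rewrite gbin0 addn0 gbinn.
have h1 : gbin (k + l).+1 k = gbin (k + l).+1 l.+1 by rewrite -addnS; apply: IH; lia.
have h2 : gbin (k + l).+1 k.+1 = gbin (k + l).+1 l by rewrite -addSn; apply: IH; lia.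
rewrite addSn addnS [LHS]gbinS [RHS]gbinS' h1 h2 addrC.
by have -> : ((k + l).+1 - l = k.+1)%N by lia.
Qed.

Definition qfact n : S := \prod_(i < n) (1 - p ^+ i.+1).

Lemma qfactS n : qfact n.+1 = qfact n * (1 - p ^+ n.+1).
Proof. exact: big_ord_recr. Qed.

Lemma gbin_qfact k l : gbin (k + l) k * (qfact k * qfact l) = qfact (k + l).
Proof.
have q0 : qfact 0 = 1 by rewrite /qfact big_ord0.
move: {2}(k + l)%N (erefl (k + l)%N) => n; elim: n k l => [|n IH] [|k] [|l] //.
- by rewrite gbin0 q0 !mul1r.
- by rewrite gbin0 q0 !mul1r.
- by rewrite addn0 gbinn q0 mul1r mulr1.
move=> e; have e1 : (k + l.+1 = n)%N by lia.
have e2 : (k.+1 + l = n)%N by lia.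
have e3 : (k.+1 + l.+1 = n.+1)%N by lia.
have := IH _ _ e2; have := IH _ _ e1; rewrite e1 e2 e3 gbinS.
rewrite !qfactS => h1 h2.
transitivity ((1 - p ^+ k.+1) * qfact n + p ^+ k.+1 * (1 - p ^+ l.+1) * qfact n).
  by rewrite -{1}h1 -h2; ring.
by rewrite -e3 exprD; ring.
Qed.

End GaussBinomial.

Section CentralGbin.
Variables (S : comNzRingType) (p : S).
Local Notation A n m := (gbin p (n + n) (n + m)).

(** Two Pascal steps, one of each kind, lead from row 2n to row 2n + 2. Once weighted, the three
    terms match (1 + x p^n)(1 + y p^n) = 1 + x p^n + y p^n + p^(2n+1), where x y = p. *)
Lemma gbin_centralS n i : A n.+1 i.+1 =
  p ^+ (n - i) * A n i + (1 + p ^+ (n + n).+1) * A n i.+1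
   + p ^+ (n + i.+2) * A n i.+2.
Proof.
rewrite [in LHS]addSn [in LHS]addnS addSn !addnS gbinS !gbinS'.
have -> : (n + n - (n + i) = n - i)%N by lia.
case: (ltnP i n) => [lt|le].
  have -> : (n + n).+1 = ((n + i).+2 + (n + n - (n + i).+1))%N by lia.
  by rewrite exprD; ring.
rewrite ![gbin p (n + n) (n + i).+1]gbin_small; last by lia.
by rewrite !mulr0 !add0r !addr0.
Qed.

Lemma gbin_central0 n : A n.+1 0 =
  (1 + p ^+ (n + n).+1) * A n 0 + p ^+ n.+1 * A n 1 *+ 2.
Proof.
have -> : A n.+1 0 = gbin p (n + n.+1).+1 n.+1 by rewrite addn0 addSn.
rewrite [LHS]gbinS gbin_sym addnS {1}gbinS gbinS' addnK addn0 addn1.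
by rewrite -addnS exprD; ring.
Qed.

End CentralGbin.

(** One half of the Jacobi sum. The weights turn the three terms of [gbin_centralS] into multiples
    by x p^n, 1 + p^(2n+1) and y p^n. The index shifts leave boundary terms in A n 0 and A n 1; the
    latter, taken over both halves, cancels against [gbin_central0]. *)
Lemma jacobi_step (S : comNzRingType) (p x y : S) (w : nat -> S) n :
  let A n m := gbin p (n + n) (n + m) in
  let W := \sum_(i < n) A n i.+1 * w i.+1 in
  x * y = p -> w 0%N = 1 -> (forall m, w m.+1 = w m * (x * p ^+ m)) ->
  \sum_(i < n.+1) A n.+1 i.+1 * w i.+1 =
    x * p ^+ n * (A n 0%N + W) + (1 + p ^+ (n + n).+1 + y * p ^+ n) * W
    - p ^+ n.+1 * A n 1%N.
Proof.
move=> A W xy w0 wS.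
have A0 m : (n < m)%N -> A n m = 0 by move=> lt; rewrite /A gbin_small //; lia.
have pS k : p ^+ k.+1 = x * y * p ^+ k by rewrite exprS xy.
have e1 : \sum_(i < n.+1) p ^+ (n - i) * A n i * w i.+1 = x * p ^+ n * (A n 0%N + W).
  transitivity (x * p ^+ n * \sum_(i < n.+1) A n i * w i).
    rewrite big_distrr; apply: eq_bigr => -[i lti] _ /=.
    by have -> : p ^+ n = p ^+ (n - i) * p ^+ i; [rewrite -exprD subnK | rewrite wS; ring].
  by rewrite big_ord_recl w0 mulr1.
have e2 : \sum_(i < n.+1) A n i.+1 * w i.+1 = W.
  by rewrite big_ord_recr /= A0 // mul0r addr0.
have e3 : \sum_(i < n.+1) p ^+ (n + i.+2) * A n i.+2 * w i.+1 =
          y * p ^+ n * W - p ^+ n.+1 * A n 1%N.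
  transitivity (y * p ^+ n * \sum_(i < n.+1) A n i.+2 * w i.+2).
    rewrite big_distrr; apply: eq_bigr => i _ /=.
    by rewrite [w i.+2]wS exprD 2!pS; ring.
  have <- : \sum_(i < n.+2) A n i.+1 * w i.+1 = W.
    by rewrite big_ord_recr /= e2 A0 // mul0r addr0.
  by rewrite [in RHS]big_ord_recl /= wS w0 expr0 mulr1 mul1r pS; ring.
transitivity (\sum_(i < n.+1) (p ^+ (n - i) * A n i * w i.+1
   + (1 + p ^+ (n + n).+1) * (A n i.+1 * w i.+1) + p ^+ (n + i.+2) * A n i.+2 * w i.+1)).
  by apply: eq_bigr => i _; rewrite /A gbin_centralS; ring.
by rewrite !big_split /= -big_distrr /= e1 e2 e3; ring.
Qed.

Lemma bin2S m : 'C(m.+1, 2) = ('C(m, 2) + m)%N.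
Proof. by rewrite binS bin1. Qed.

(** Setting p = x y keeps the identity polynomial: terms of negative index appear with x and y
    exchanged, and [jacobi_step] serves both halves. *)
Lemma finite_jacobi (S : comNzRingType) (x y : S) n :
  let p := x * y in
  \prod_(i < n) ((1 + x * p ^+ i) * (1 + y * p ^+ i)) =
  gbin p (n + n) n +
  \sum_(i < n) gbin p (n + n) (n + i.+1) *
    (x ^+ 'C(i.+2, 2) * y ^+ 'C(i.+1, 2) + x ^+ 'C(i.+1, 2) * y ^+ 'C(i.+2, 2)).
Proof.
move=> p; pose w m := x ^+ 'C(m.+1, 2) * y ^+ 'C(m, 2).
pose w' m := x ^+ 'C(m, 2) * y ^+ 'C(m.+1, 2).
have wS m : w m.+1 = w m * (x * p ^+ m).
  by rewrite /w /p !bin2S !exprD exprMn exprS; ring.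
have w'S m : w' m.+1 = w' m * (y * p ^+ m).
  by rewrite /w' /p !bin2S !exprD exprMn exprS; ring.
have w0 : w 0%N = 1 by rewrite /w !expr0 mulr1.
have w'0 : w' 0%N = 1 by rewrite /w' !expr0 mulr1.
have split_w k : \sum_(i < k) gbin p (k + k) (k + i.+1) * (w i.+1 + w' i.+1) =
  \sum_(i < k) gbin p (k + k) (k + i.+1) * w i.+1 +
  \sum_(i < k) gbin p (k + k) (k + i.+1) * w' i.+1.
  by rewrite -big_split; apply: eq_bigr => i _; rewrite mulrDr.
elim: n => [|n]; first by rewrite !big_ord0 addr0 gbin0.
move=> IH; rewrite big_ord_recr IH -[LHS]/(_ * ((1 + x * p ^+ n) * (1 + y * p ^+ n))).
have := gbin_central0 p n; rewrite !addn0 => ->.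
rewrite !split_w (jacobi_step (y := y) _ _ w0 wS) //.
rewrite (jacobi_step (y := x) _ _ w'0 w'S) 1?mulrC //.
rewrite !addn0 ![p ^+ _.+1]exprS exprD; have -> : p = x * y by [].
ring.
Qed.

(** * Euler products *)

Section EulerProducts.
Variable R : comNzRingType.
Local Notation X := (fpsX R).

(** Over any ring, because the cubic norm needs a cube root of unity; over [int] it is [etaE]. *)
Definition eulerE (a : nat) : fps R :=
  fun n => (\prod_(1 <= m < n.+1) (1 - 'X^(a * m)) : {poly R})`_n.
Definition eulerEinv (a : nat) : fps R :=
  fun n => (\prod_(1 <= m < n.+1) \sum_(j < n.+1) 'X^(a * m * j) : {poly R})`_n.

Lemma eqmod_fpsX N k : (N <= k)%N -> fps_eqmod N (X ^+ k) 0.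
Proof.
move=> le n lt; rewrite fpsXnE fps0 /fps_of_poly coefXn.
by case: eqP => // e; lia.
Qed.

Lemma eqmod_1subX N k : (N <= k)%N -> fps_eqmod N (1 - X ^+ k) 1.
Proof.
by move=> le; rewrite -[X in fps_eqmod _ _ X]subr0; apply/fps_eqmodB/eqmod_fpsX.
Qed.

Lemma eqmod_sum0 N m (F : 'I_m -> fps R) :
  (forall i, fps_eqmod N (F i) 0) -> fps_eqmod N (\sum_i F i) 0.
Proof.
move=> F0; elim/big_rec: _ => // i f _ f0.
by rewrite -[X in fps_eqmod _ _ X]addr0; apply: fps_eqmodD.
Qed.

Lemma eqmod_prod1 N m (F : 'I_m -> fps R) :
  (forall i, fps_eqmod N (F i) 1) -> fps_eqmod N (\prod_i F i) 1.
Proof.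
move=> F1; elim/big_rec: _ => // i f _ f1.
by rewrite -[X in fps_eqmod _ _ X]mulr1; apply: fps_eqmodM.
Qed.

Lemma qfact_eqmod a n m : (n <= m)%N ->
  fps_eqmod (a * n.+1) (qfact (X ^+ a) m) (qfact (X ^+ a) n).
Proof.
move/subnKC <-; elim: (m - n)%N => [|k IH]; first by rewrite addn0.
rewrite addnS qfactS; rewrite -[qfact (X ^+ a) n]mulr1; apply: fps_eqmodM => //.
rewrite -exprM; apply: eqmod_1subX; rewrite leq_mul2l; apply/orP; right; lia.
Qed.

Lemma fps_of_prod n (F : nat -> {poly R}) :
  fps_of_poly (\prod_(1 <= m < n.+1) F m) = \prod_(i < n) fps_of_poly (F i.+1).
Proof. by rewrite big_add1 big_mkord rmorph_prod. Qed.

Lemma eulerE_eqmod a M : (0 < a)%N ->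
  fps_eqmod M.+1 (eulerE a) (qfact (X ^+ a) M).
Proof.
move=> a0 n ltnM; transitivity (qfact (X ^+ a) n n); last first.
  by have le : (n <= M)%N := ltnM; rewrite (qfact_eqmod le) //; nia.
rewrite -[LHS]/(fps_of_poly (\prod_(1 <= m < n.+1) (1 - 'X^(a * m))) n) fps_of_prod /qfact.
by congr (_ n); apply: eq_bigr => i _; rewrite rmorphB rmorph1 /= -fpsXnE exprM.
Qed.

Lemma eulerEinv_eqmod a M : (0 < a)%N ->
  fps_eqmod M.+1 (eulerEinv a)
    (\prod_(i < M) \sum_(j < M.+1) X ^+ (a * i.+1 * j)).
Proof.
move=> a0 n ltnM.
pose G m k : fps R := \prod_(i < m) \sum_(j < k) X ^+ (a * i.+1 * j).
transitivity (G n n.+1 n).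
  rewrite -[LHS]/(fps_of_poly (\prod_(1 <= m < n.+1) \sum_(j < n.+1) 'X^(a * m * j)) n).
  rewrite fps_of_prod.
  congr (_ n); apply: eq_bigr => i _; rewrite rmorph_sum.
  by apply: eq_bigr => j _; rewrite /= -fpsXnE.
have factor m k : (n < k)%N ->
  fps_eqmod n.+1 (\sum_(j < k) X ^+ (a * m.+1 * j)) (\sum_(j < n.+1) X ^+ (a * m.+1 * j)).
  move=> /subnKC <-; elim: (k - n.+1)%N => [|l IH]; first by rewrite addn0.
  rewrite addnS big_ord_recr /= -[X in fps_eqmod _ _ X]addr0.
  by apply: fps_eqmodD => //; apply: eqmod_fpsX; nia.
transitivity (G M n.+1 n); last first.
  by apply: (@fps_eqmod_prod _ n.+1) => // i _; apply: fps_eqmod_sym; apply: factor.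
have le : (n <= M)%N by lia.
suff h : fps_eqmod n.+1 (G M n.+1) (G n n.+1) by rewrite h.
rewrite -(subnKC le); elim: (M - n)%N => [|k IH]; first by rewrite addn0.
rewrite addnS /G big_ord_recr /= -[X in fps_eqmod _ _ X]mulr1.
apply: fps_eqmodM => //; rewrite big_ord_recl muln0 expr0 -[X in fps_eqmod _ _ X]addr0.
apply: fps_eqmodD => //; apply: eqmod_sum0 => i; apply: eqmod_fpsX.
by rewrite lift0 mulnAC (leq_trans _ (leq_pmull _ _)) ?muln_gt0 ?a0 /=; lia.
Qed.

Lemma eulerE_mulV a : (0 < a)%N -> eulerE a * eulerEinv a = 1.
Proof.
move=> a0; apply: fps_eqmodP => N; apply: (@fps_eqmod_le _ _ N.+1) => //.
apply: fps_eqmod_trans; first exact: fps_eqmodM (eulerE_eqmod a0) (eulerEinv_eqmod a0).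
rewrite -big_split; apply: eqmod_prod1 => i /=; under eq_bigr do rewrite exprM.
rewrite -opprB mulNr -exprM -subrX1 opprB -exprM.
by apply: eqmod_1subX; nia.
Qed.

Lemma eulerE_const a : eulerE a 0%N = 1.
Proof. by rewrite /eulerE big_geq // coef1. Qed.
Lemma eulerEinv_const a : eulerEinv a 0%N = 1.
Proof. by rewrite /eulerEinv big_geq // coef1. Qed.

Lemma eulerE_neq0 a : eulerE a != 0.
Proof.
apply/eqP => /(congr1 (@fps_const R))/eqP.
by rewrite rmorph0 /fps_const eulerE_const oner_eq0.
Qed.

Lemma eulerE_subst r a : (0 < a)%N -> fps_subst r (eulerE a) = eulerE (a * r.+1).
Proof.
move=> a0; apply: fps_eqmodP => N; apply: (@fps_eqmod_le _ _ N.+1) => //.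
have ar0 : (0 < a * r.+1)%N by rewrite muln_gt0 a0.
apply: (fps_eqmod_trans (fps_subst r (qfact (X ^+ a) N))).
  by apply/fps_eqmod_subst/eulerE_eqmod.
apply: fps_eqmod_sym; apply: fps_eqmod_trans (eulerE_eqmod ar0) _.
rewrite rmorph_prod => n _; congr (_ n); apply: eq_bigr => i _.
by rewrite rmorphB rmorph1 !rmorphXn /= fps_substX -!exprM mulnA [(r.+1 * a)%N]mulnC.
Qed.

(** By the product formula the binomial is a quotient of q-factorials of lengths 2n, n + m and n -
    m. Each agrees with the Euler product modulo q^(n-m+1), so the binomial agrees with its
    inverse. *)
Lemma gbin_eqmod c n m : (0 < c)%N -> (m <= n)%N ->
  fps_eqmod (n - m).+1 (gbin (X ^+ c) (n + n) (n + m) * eulerE c) 1.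
Proof.
move=> c0 lemn; set g := gbin _ _ _.
have lim k : (n - m <= k)%N -> fps_eqmod (n - m).+1 (qfact (X ^+ c) k) (eulerE c).
  by move=> le; apply/fps_eqmod_sym/(fps_eqmod_le _ (eulerE_eqmod _)).
have := gbin_qfact (X ^+ c) (n + m) (n - m).
have -> : (n + m + (n - m) = n + n)%N by lia.
rewrite -/g => e.
have e1 : fps_eqmod (n - m).+1 (g * (eulerE c * eulerE c)) (eulerE c).
  apply: (fps_eqmod_trans (g * (qfact (X ^+ c) (n + m) * qfact (X ^+ c) (n - m)))).
    by apply: fps_eqmodM => //; apply: fps_eqmodM; apply/fps_eqmod_sym/lim; lia.
  by rewrite e; apply: lim; lia.
rewrite -(eulerE_mulV c0).
have -> : g * eulerE c = g * (eulerE c * eulerE c) * eulerEinv c.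
  by rewrite -!mulrA eulerE_mulV // mulr1.
exact: fps_eqmodM.
Qed.

(* The terms j = 0 and j = +-(i+1), |j| <= M, of Jacobi's theta series
   sum_j (-1)^j q^(a j(j+1)/2 + b j(j-1)/2). *)
Definition theta_partial a b M : fps R :=
  1 + \sum_(i < M) (-1) ^+ i.+1 *
    (X ^+ (a * 'C(i.+2, 2) + b * 'C(i.+1, 2)) + X ^+ (a * 'C(i.+1, 2) + b * 'C(i.+2, 2))).

Definition arith_prod a c M : fps R := \prod_(i < M) (1 - X ^+ (a + c * i)).

Lemma jacobi_triple a b M : (0 < a)%N -> (0 < b)%N ->
  fps_eqmod M.+1 (arith_prod a (a + b) M * arith_prod b (a + b) M * eulerE (a + b))
    (theta_partial a b M).
Proof.
move=> a0 b0; have c0 : (0 < a + b)%N by lia.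
have xy : (- X ^+ a) * (- X ^+ b) = X ^+ (a + b) by rewrite mulrNN exprD.
have := finite_jacobi (- X ^+ a) (- X ^+ b) M; rewrite /= xy => fj.
have -> : arith_prod a (a + b) M * arith_prod b (a + b) M =
  \prod_(i < M) ((1 - X ^+ a * X ^+ (a + b) ^+ i) * (1 - X ^+ b * X ^+ (a + b) ^+ i)).
  by rewrite -big_split; apply: eq_bigr => i _; rewrite -!exprM -!exprD.
under eq_bigr do rewrite -!mulNr.
rewrite fj mulrDl big_distrl /=; apply: fps_eqmodD.
  have := gbin_eqmod c0 (leq0n M); rewrite addn0 subn0; exact.
apply: fps_eqmod_sum => -[i ltiM] _ /=.
have sgnX k l : (- X ^+ a) ^+ k * (- X ^+ b) ^+ l = (-1) ^+ (k + l) * X ^+ (a * k + b * l).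
  by rewrite ![(- X ^+ _) ^+ _]exprNn -!exprM !exprD; ring.
have sg : (-1) ^+ ('C(i.+2, 2) + 'C(i.+1, 2)) = (-1) ^+ i.+1 :> fps R.
  by rewrite -[LHS]signr_odd -[RHS]signr_odd bin2S; congr (_ ^+ nat_of_bool _); lia.
rewrite !sgnX [('C(i.+1, 2) + _)%N]addnC sg -mulrDr.
set s := (-1) ^+ i.+1; set g := gbin _ _ _.
have -> : forall u v, g * (s * (u + v)) * eulerE (a + b) =
  s * (u * (g * eulerE (a + b)) + v * (g * eulerE (a + b))) by move=> u v; ring.
apply: fps_eqmodM => //.
rewrite -[X in fps_eqmod _ _ (X + _)]mulr1 -[X in fps_eqmod _ _ (_ + X)]mulr1.
(* The binomial is known only modulo q^(M-i), but it is multiplied by a power of q of exponent at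
   least i + 1. *)
have tri : (i.+1 <= 'C(i.+2, 2))%N by rewrite bin2S; lia.
by apply: fps_eqmodD; apply: (fps_eqmodXM _ (gbin_eqmod c0 ltiM)); nia.
Qed.

End EulerProducts.

(** * The 3-dissection of phi(-q) and its cubic norm *)

Section ResidueClasses.
Variable S : comNzRingType.
Implicit Types z t : S.

Lemma qfact_mod2 z M :
  \prod_(i < M) (1 - z ^+ (2 * i).+1) * qfact (z ^+ 2) M = qfact z (2 * M).
Proof.
elim: M => [|M IH]; first by rewrite muln0 /qfact !big_ord0 mulr1.
have e : (2 * M.+1 = (2 * M).+2)%N by lia.
by rewrite big_ord_recr /= qfactS -exprM e !qfactS -IH; ring.
Qed.

(** Inclusion-exclusion: the exponents up to 6M are those prime to 6 (residues 1 and 5) and the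
    multiples of 2 and of 3, the multiples of 6 being counted twice. *)
Lemma qfact_mod6 z M :
  \prod_(i < M) (1 - z ^+ (6 * i).+1) * \prod_(i < M) (1 - z ^+ (6 * i).+4.+1) *
    (qfact (z ^+ 2) (3 * M) * qfact (z ^+ 3) (2 * M)) =
  qfact z (6 * M) * qfact (z ^+ 6) M.
Proof.
elim: M => [|M IH]; first by rewrite !muln0 /qfact !big_ord0; ring.
have -> : (2 * M.+1 = (2 * M).+2)%N by lia.
have -> : (3 * M.+1 = (3 * M).+3)%N by lia.
have -> : (6 * M.+1 = (6 * M).+4.+2)%N by lia.
rewrite !big_ord_recr /= !qfactS.
set A := \prod_(i < M) _ in IH *; set B := \prod_(i < M) _ in IH *.
set C := qfact (z ^+ 2) _ in IH *; set D := qfact (z ^+ 3) _ in IH *.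
set F := qfact z _ in IH *; set G := qfact (z ^+ 6) _ in IH *.
have pw a b k : (a * b = k)%N -> (z ^+ a) ^+ b = z ^+ k by move=> <-; rewrite exprM.
rewrite (pw 2 _ (6 * M).+2); last by lia.
rewrite (pw 2 _ (6 * M).+4); last by lia.
rewrite (pw 2 _ (6 * M).+4.+2); last by lia.
rewrite (pw 3 _ (6 * M).+3); last by lia.
rewrite (pw 3 _ (6 * M).+4.+2); last by lia.
rewrite (pw 6 _ (6 * M).+4.+2); last by lia.
transitivity ((A * B * (C * D)) * (1 - z ^+ (6 * M).+1) * (1 - z ^+ (6 * M).+2) *
  (1 - z ^+ (6 * M).+3) * (1 - z ^+ (6 * M).+4) * (1 - z ^+ (6 * M).+4.+1) *
  (1 - z ^+ (6 * M).+4.+2) ^+ 2); first by ring.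
by rewrite IH; ring.
Qed.

(** For k prime to 3 the three conjugate factors multiply to 1 - z^(3k); for 3 | k they coincide and
    give a cube. The factor at z^9 supplies the missing multiples of 3. *)
Lemma qfact_cubic_norm z t M : 1 + t + t ^+ 2 = 0 ->
  qfact z (3 * M) * qfact (t * z) (3 * M) * qfact (t ^+ 2 * z) (3 * M) *
    qfact (z ^+ 9) M = qfact (z ^+ 3) (3 * M) * qfact (z ^+ 3) M ^+ 3.
Proof.
move=> t0; have t3 : t ^+ 3 = 1.
  by transitivity (1 + (t - 1) * (1 + t + t ^+ 2)); [|rewrite t0]; ring.
elim: M => [|M IH]; first by rewrite !muln0 /qfact !big_ord0; ring.
have -> : (3 * M.+1 = (3 * M).+3)%N by lia.
rewrite !qfactS.
set A := qfact z _ in IH *; set B := qfact (t * z) _ in IH *.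
set C := qfact (t ^+ 2 * z) _ in IH *; set D := qfact (z ^+ 9) _ in IH *.
set F := qfact (z ^+ 3) _ in IH *; set G := qfact (z ^+ 3) M in IH *.
have pw a b k : (a * b = k)%N -> (z ^+ a) ^+ b = z ^+ k by move=> <-; rewrite exprM.
have tw l : t ^+ (3 * M + l) = t ^+ l by rewrite exprD exprM t3 expr1n mul1r.
rewrite !(exprMn _ (t ^+ 2) z) !(exprMn _ t z) !(exprAC t 2).
have -> : t ^+ (3 * M).+1 = t by rewrite -addn1 tw.
have -> : t ^+ (3 * M).+2 = t ^+ 2 by rewrite -addn2 tw.
have -> : t ^+ (3 * M).+3 = 1 by rewrite -addn3 tw.
rewrite (pw 9 _ (9 * M).+4.+4.+1); last by lia.
rewrite (pw 3 (3 * M).+1 (9 * M).+3); last by lia.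
rewrite (pw 3 (3 * M).+2 (9 * M).+4.+2); last by lia.
rewrite (pw 3 (3 * M).+3 (9 * M).+4.+4.+1); last by lia.
rewrite (pw 3 M.+1 (3 * M).+3); last by lia.
have p3 k l : l = (3 * k)%N -> z ^+ l = (z ^+ k) ^+ 3 by move=> ->; rewrite mulnC exprM.
rewrite (p3 (3 * M).+1 (9 * M).+3); last by lia.
rewrite (p3 (3 * M).+2 (9 * M).+4.+2); last by lia.
have norm y : (1 - y) * (1 - t * y) * (1 - t ^+ 2 * y) = 1 - y ^+ 3.
  transitivity (1 - (1 + t + t ^+ 2) * y + t * (1 + t + t ^+ 2) * y ^+ 2 - t ^+ 3 * y ^+ 3).
    by ring.
  by rewrite t0 t3; ring.
rewrite -!norm.
set y1 := z ^+ (3 * M).+1; set y2 := z ^+ (3 * M).+2; set y3 := z ^+ (3 * M).+3.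
transitivity (A * B * C * D * (((1 - y1) * (1 - t * y1) * (1 - t ^+ 2 * y1)) *
  ((1 - y2) * (1 - t * y2) * (1 - t ^+ 2 * y2)) * ((1 - y3) * (1 - y3) * (1 - y3) *
  (1 - z ^+ (9 * M).+4.+4.+1)))).
  have t22 : (t ^+ 2) ^+ 2 = t by rewrite -exprM (exprD t 3 1) t3 mul1r.
  by rewrite t22 !expr1n !mul1r; ring.
by rewrite IH; ring.
Qed.
End ResidueClasses.

Section PhiDissection.
Variable R : comNzRingType.
Local Notation X := (fpsX R).
Local Notation E := (eulerE R).

(** The case a = b of the triple product: the theta series is phi(-q^a), with exponents a j^2. *)
Lemma phi_limit a M : (0 < a)%N ->
  fps_eqmod M.+1 (E a ^+ 2) (E (a + a) * theta_partial R a a M).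
Proof.
move=> a0; have aa0 : (0 < a + a)%N by lia.
have e : arith_prod R a (a + a) M * qfact (X ^+ (a + a)) M = qfact (X ^+ a) (2 * M).
  rewrite addnn -mul2n mulnC exprM -qfact_mod2; congr (_ * _).
  by apply: eq_bigr => i _; rewrite -exprM; congr (1 - _ ^+ _); lia.
have h : fps_eqmod M.+1 (arith_prod R a (a + a) M * E (a + a)) (E a).
  apply: (fps_eqmod_trans (arith_prod R a (a + a) M * qfact (X ^+ (a + a)) M)).
    by apply: fps_eqmodM => //; apply: eulerE_eqmod.
  by rewrite e; apply/fps_eqmod_sym/(fps_eqmod_le _ (eulerE_eqmod _ a0)); lia.
apply: (fps_eqmod_trans ((arith_prod R a (a + a) M * E (a + a)) ^+ 2)).
  exact/fps_eqmod_sym/fps_eqmodX.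
have -> : (arith_prod R a (a + a) M * E (a + a)) ^+ 2 =
  E (a + a) * (arith_prod R a (a + a) M * arith_prod R a (a + a) M * E (a + a)) by ring.
by apply: fps_eqmodM => //; apply: jacobi_triple.
Qed.

(** The triple product at (a, 5a), with theta exponents a (3 j^2 - 2 j); [qfact_mod6] turns the two
    progressions into Euler products. *)
Lemma omega_limit a M : (0 < a)%N ->
  fps_eqmod M.+1 (E a * E (6 * a) ^+ 2)
    (E (2 * a) * E (3 * a) * theta_partial R a (5 * a) M).
Proof.
move=> a0; have aa : (a + 5 * a = 6 * a)%N by lia.
set O1 := arith_prod R a (6 * a) M; set O5 := arith_prod R (5 * a) (6 * a) M.
have e : O1 * O5 * (qfact (X ^+ (2 * a)) (3 * M) * qfact (X ^+ (3 * a)) (2 * M)) =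
    qfact (X ^+ a) (6 * M) * qfact (X ^+ (6 * a)) M.
  rewrite ![(_ * a)%N]mulnC !exprM -qfact_mod6.
  congr (_ * _ * _); apply: eq_bigr => i _; rewrite -exprM; congr (1 - _ ^+ _); lia.
have a2 : (0 < 2 * a)%N by lia.
have a3 : (0 < 3 * a)%N by lia.
have a6 : (0 < 6 * a)%N by lia.
have h : fps_eqmod M.+1 (O1 * O5 * (E (2 * a) * E (3 * a))) (E a * E (6 * a)).
  apply: (fps_eqmod_trans
    (O1 * O5 * (qfact (X ^+ (2 * a)) (3 * M) * qfact (X ^+ (3 * a)) (2 * M)))).
    apply: fps_eqmodM => //.
    by apply: fps_eqmodM; apply: fps_eqmod_le (eulerE_eqmod _ _) => //; lia.
  rewrite e; apply: fps_eqmod_sym.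
  by apply: fps_eqmodM; apply: fps_eqmod_le (eulerE_eqmod _ _) => //; lia.
apply: (fps_eqmod_trans (O1 * O5 * (E (2 * a) * E (3 * a)) * E (6 * a))).
  have -> : E a * E (6 * a) ^+ 2 = E a * E (6 * a) * E (6 * a) by ring.
  by apply: fps_eqmodM => //; apply: fps_eqmod_sym.
have -> : O1 * O5 * (E (2 * a) * E (3 * a)) * E (6 * a) =
  E (2 * a) * E (3 * a) * (O1 * O5 * E (6 * a)) by ring.
have a5 : (0 < 5 * a)%N by lia.
by apply: fps_eqmodM => //; rewrite -aa /O1 /O5 -aa; apply: jacobi_triple.
Qed.

(** Split the sum of (-1)^j q^(j^2) by j modulo 3. Class 0 gives exponents 9 m^2; classes 1 and -1
    are exchanged by j -> -j, and each gives -q times the series with exponents 9 m^2 - 6 m. The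
    cutoff 3N + 1 makes the finite sums agree exactly. *)
Lemma theta_dissection N :
  theta_partial R 1 1 (3 * N).+1 =
  theta_partial R 9 9 N - 2 * X * theta_partial R 3 15 N.
Proof.
have b2 n : ('C(n, 2) * 2 + n = n * n)%N.
  by elim: n => // n IH; rewrite bin2S; lia.
have tS a b M : theta_partial R a b M.+1 = theta_partial R a b M + (-1) ^+ M.+1 *
    (X ^+ (a * 'C(M.+2, 2) + b * 'C(M.+1, 2)) + X ^+ (a * 'C(M.+1, 2) + b * 'C(M.+2, 2))).
  by rewrite /theta_partial big_ord_recr addrA.
elim: N => [|N IH].
  rewrite muln0 tS /theta_partial !big_ord0 !bin2S /= muln0 !mul1n !addn0 !add0n.
  by rewrite !expr1; ring.
have -> : (3 * N.+1).+1 = (3 * N).+4 by lia.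
rewrite 3!(tS 1%N 1%N) (tS 9%N) (tS 3%N) {}IH.
have sg k l : odd k = odd l -> (-1) ^+ k = (-1) ^+ l :> fps R.
  by move=> e; rewrite -signr_odd e signr_odd.
rewrite (sg (3 * N).+2 N) ?(sg (3 * N).+3 N.+1) ?(sg (3 * N).+4 N); try lia.
set p1 := (3 * 'C(N.+2, 2) + 15 * 'C(N.+1, 2))%N.
set p2 := (3 * 'C(N.+1, 2) + 15 * 'C(N.+2, 2))%N.
set p3 := (9 * 'C(N.+2, 2) + 9 * 'C(N.+1, 2))%N.
have := b2 (3 * N)%N; have := b2 N => d0 c0.
have -> : (9 * 'C(N.+1, 2) + 9 * 'C(N.+2, 2) = p3)%N by rewrite addnC.
have -> : (1 * 'C((3 * N).+3, 2) + 1 * 'C((3 * N).+2, 2) = p1.+1)%N by rewrite /p1 !bin2S; lia.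
have -> : (1 * 'C((3 * N).+2, 2) + 1 * 'C((3 * N).+3, 2) = p1.+1)%N by rewrite /p1 !bin2S; lia.
have -> : (1 * 'C((3 * N).+4, 2) + 1 * 'C((3 * N).+3, 2) = p3)%N by rewrite /p3 !bin2S; lia.
have -> : (1 * 'C((3 * N).+3, 2) + 1 * 'C((3 * N).+4, 2) = p3)%N by rewrite /p3 !bin2S; lia.
have -> : (1 * 'C((3 * N).+1.+4, 2) + 1 * 'C((3 * N).+4, 2) = p2.+1)%N by rewrite /p2 !bin2S; lia.
have -> : (1 * 'C((3 * N).+4, 2) + 1 * 'C((3 * N).+1.+4, 2) = p2.+1)%N by rewrite /p2 !bin2S; lia.
by rewrite !exprS; ring.
Qed.

Lemma phi_dissection :
  E 1 ^+ 2 * (E 18 * E 6 * E 9) =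
  E 2 * (E 9 ^+ 3 * E 6 - 2 * X * (E 3 * E 18 ^+ 3)).
Proof.
apply: fps_eqmodP => N; apply: (@fps_eqmod_le _ _ N.+1) => //.
have h1 : fps_eqmod N.+1 (E 1 ^+ 2) (E 2 * theta_partial R 1 1 (3 * N).+1).
  by apply: (fps_eqmod_le _ (@phi_limit 1 (3 * N).+1 _)) => //; lia.
have h2 : fps_eqmod N.+1 (E 9 ^+ 2) (E 18 * theta_partial R 9 9 N) by apply: phi_limit.
have h3 : fps_eqmod N.+1 (E 3 * E 18 ^+ 2) (E 6 * E 9 * theta_partial R 3 15 N).
  exact: (@omega_limit 3).
apply: (fps_eqmod_trans (E 2 * theta_partial R 1 1 (3 * N).+1 * (E 18 * E 6 * E 9))).
  exact: fps_eqmodM.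
rewrite theta_dissection.
have -> : E 2 * (theta_partial R 9 9 N - 2 * X * theta_partial R 3 15 N) * (E 18 * E 6 * E 9) =
  E 2 * (E 18 * theta_partial R 9 9 N * (E 6 * E 9) -
         2 * X * (E 6 * E 9 * theta_partial R 3 15 N * E 18)) by ring.
have -> : E 9 ^+ 3 * E 6 - 2 * X * (E 3 * E 18 ^+ 3) =
  E 9 ^+ 2 * (E 6 * E 9) - 2 * X * (E 3 * E 18 ^+ 2 * E 18) by ring.
apply: fps_eqmodM => //; apply: fps_eqmodB.
  by apply: fps_eqmodM => //; apply: fps_eqmod_sym.
by apply: fps_eqmodM => //; apply: fps_eqmodM => //; apply: fps_eqmod_sym.
Qed.

End PhiDissection.

(** The dissection is multiplied by its conjugates under q -> t q and q -> t^2 q: the factors a - 2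
    b, a - 2 t b and a - 2 t^2 b have product a^3 - 8 b^3. *)
Lemma cubic_norm_elim (S : idomainType) (e1 e1' e1'' e2 e2' e2'' e3 e6 e9 e18 x t : S) :
  1 + t + t ^+ 2 = 0 -> e6 != 0 -> e9 != 0 ->
  e1 ^+ 2 * (e18 * e6 * e9) = e2 * (e9 ^+ 3 * e6 - 2 * x * (e3 * e18 ^+ 3)) ->
  e1' ^+ 2 * (e18 * e6 * e9) =
    e2' * (e9 ^+ 3 * e6 - 2 * (t * x) * (e3 * e18 ^+ 3)) ->
  e1'' ^+ 2 * (e18 * e6 * e9) =
    e2'' * (e9 ^+ 3 * e6 - 2 * (t ^+ 2 * x) * (e3 * e18 ^+ 3)) ->
  e1 * e1' * e1'' * e9 = e3 ^+ 4 -> e2 * e2' * e2'' * e18 = e6 ^+ 4 ->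
  e3 ^+ 8 * e18 ^+ 4 * e9 = e6 * (e9 ^+ 9 * e6 ^+ 3 - 8 * x ^+ 3 * e3 ^+ 3 * e18 ^+ 9).
Proof.
move=> t0 n6 n9 d0 d1 d2 n1 n2.
have t3 : t ^+ 3 = 1.
  by transitivity (1 + (t - 1) * (1 + t + t ^+ 2)); [|rewrite t0]; ring.
have nz : e6 ^+ 3 * e9 ^+ 2 != 0 by rewrite mulf_neq0 ?expf_neq0.
apply: (mulfI nz).
transitivity ((e1 * e1' * e1'' * e9) ^+ 2 * e18 * (e18 * e6 * e9) ^+ 3).
  by rewrite n1; ring.
transitivity ((e1 ^+ 2 * (e18 * e6 * e9)) * (e1' ^+ 2 * (e18 * e6 * e9)) *
  (e1'' ^+ 2 * (e18 * e6 * e9)) * (e9 ^+ 2 * e18)); first by ring.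
rewrite d0 d1 d2.
set a := e9 ^+ 3 * e6; set b := x * (e3 * e18 ^+ 3).
transitivity (e2 * e2' * e2'' * e18 * e9 ^+ 2 *
  (a ^+ 3 - 2 * b * a ^+ 2 * (1 + t + t ^+ 2) + 4 * b ^+ 2 * a * t * (1 + t + t ^+ 2)
   - 8 * b ^+ 3 * t ^+ 3)); first by rewrite /b; ring.
by rewrite n2 t0 t3 /a /b; ring.
Qed.

Section CubicNorm.
Variables (R : idomainType) (z : R).
Hypothesis z_cubic : 1 + z + z ^+ 2 = 0.
Local Notation X := (fpsX R).
Local Notation E := (eulerE R).
Local Notation t := (fps_scal z).

Let t_cubic : 1 + t + t ^+ 2 = 0.
Proof. by rewrite -rmorphXn -(rmorph1 (@fps_scal R)) -!rmorphD z_cubic rmorph0. Qed.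

Let z3 : z ^+ 3 = 1.
Proof. by transitivity (1 + (z - 1) * (1 + z + z ^+ 2)); [|rewrite z_cubic]; ring. Qed.

Lemma eulerE_cubic_norm1 :
  E 1 * fps_twist z (E 1) * fps_twist (z ^+ 2) (E 1) * E 9 = E 3 ^+ 4.
Proof.
apply: fps_eqmodP => N; apply: (@fps_eqmod_le _ _ N.+1) => //.
have lim a M : (0 < a)%N -> (N <= M)%N -> fps_eqmod N.+1 (qfact (X ^+ a) M) (E a).
  by move=> a0 le; apply/fps_eqmod_sym/(fps_eqmod_le _ (eulerE_eqmod _ a0)).
have tw y M : fps_twist y (qfact X M) = qfact (fps_scal y * X) M.
  rewrite /qfact rmorph_prod; apply: eq_bigr => i _.
  by rewrite rmorphB rmorph1 rmorphXn /= fps_twistX.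
have t2 : t ^+ 2 = fps_scal (z ^+ 2) by rewrite rmorphXn.
have := qfact_cubic_norm X N t_cubic; rewrite t2 -!tw => e.
have lim1 : fps_eqmod N.+1 (qfact X (3 * N)) (E 1) by rewrite -{1}[X]expr1; apply: lim => //; lia.
apply: (fps_eqmod_trans (qfact X (3 * N) * fps_twist z (qfact X (3 * N)) *
   fps_twist (z ^+ 2) (qfact X (3 * N)) * qfact (X ^+ 9) N)).
  apply/fps_eqmod_sym/fps_eqmodM; last exact: lim.
  by do 2![apply: fps_eqmodM; last exact: fps_eqmod_twist].
by rewrite e [E 3 ^+ 4]exprS; apply: fps_eqmodM; [|apply: fps_eqmodX]; apply: lim => //; lia.
Qed.

Lemma eulerE_cubic_norm2 :
  E 2 * fps_twist z (E 2) * fps_twist (z ^+ 2) (E 2) * E 18 = E 6 ^+ 4.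
Proof.
have s1 a : (0 < a)%N -> E (a * 2) = fps_subst 1 (E a) by move=> a0; rewrite eulerE_subst.
rewrite (s1 1%N) // (s1 9%N) // (s1 3%N) // !fps_twist_subst -[RHS]rmorphXn.
rewrite -eulerE_cubic_norm1 !rmorphM.
have -> : (z ^+ 2) ^+ 2 = z by rewrite -exprM (exprD z 3 1) z3 mul1r.
by rewrite /=; ring.
Qed.

(** Proved at q^3 and pulled back by injectivity. Euler products of index divisible by 3 are fixed
    by the twist, so only those of index 1 and 2 have nontrivial conjugates, and their norms are
    known. *)
Lemma eulerE_cubic_relation :
  E 1 ^+ 8 * E 6 ^+ 4 * E 3 = E 2 * (E 3 ^+ 9 * E 2 ^+ 3 - 8 * X * E 1 ^+ 3 * E 6 ^+ 9).
Proof.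
have s3 a : (0 < a)%N -> E (a * 3) = fps_subst 2 (E a) by move=> a0; rewrite eulerE_subst.
have fix1 a : (0 < a)%N -> fps_twist z (E (a * 3)) = E (a * 3).
  by move=> a0; rewrite s3 // fps_twist_subst z3 fps_twist1.
have fix2 a : (0 < a)%N -> fps_twist (z ^+ 2) (E (a * 3)) = E (a * 3).
  by move=> a0; rewrite s3 // fps_twist_subst exprAC z3 expr1n fps_twist1.
apply: (@fps_subst_inj _ 2).
rewrite !(rmorphXn, rmorphM, rmorphB) /= fps_substX rmorph_nat !eulerE_subst //=.
have d0 := phi_dissection R.
have d1 := congr1 (fps_twist z) d0; have d2 := congr1 (fps_twist (z ^+ 2)) d0.
rewrite !(rmorphXn, rmorphM, rmorphB) /= !rmorph_nat !fps_twistX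
  (fix1 1%N) // (fix1 2%N) // (fix1 3%N) // (fix1 6%N) // in d1.
rewrite !(rmorphXn, rmorphM, rmorphB) /= !rmorph_nat !fps_twistX
  (fix2 1%N) // (fix2 2%N) // (fix2 3%N) // (fix2 6%N) // in d2.
have t2 : fps_scal (z ^+ 2) = t ^+ 2 by rewrite rmorphXn.
rewrite t2 in d2.
exact: (cubic_norm_elim t_cubic (eulerE_neq0 _ _) (eulerE_neq0 _ _) d0 d1 d2
  eulerE_cubic_norm1 eulerE_cubic_norm2).
Qed.
End CubicNorm.

Lemma eulerE_map (R S : comNzRingType) (phi : {rmorphism R -> S}) a :
  fps_map phi (eulerE R a) = eulerE S a.
Proof.
apply: fpsP => n; rewrite /fps_map /eulerE -coef_map rmorph_prod.
by under eq_bigr do rewrite rmorphB rmorph1 /= map_polyXn.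
Qed.

Lemma eulerE_relation :
  let E := eulerE int in
  E 1 ^+ 8 * E 6 ^+ 4 * E 3 =
  E 2 * (E 3 ^+ 9 * E 2 ^+ 3 - 8 * fpsX int * E 1 ^+ 3 * E 6 ^+ 9).
Proof.
have [z prim_z] := C_prim_root_exists (isT : (0 < 3)%N).
have z0 : 1 + z + z ^+ 2 = 0.
  have z1 : z - 1 != 0 by rewrite subr_eq0 -[z]expr1 -(prim_order_dvd prim_z).
  apply: (mulfI z1); rewrite mulr0.
  transitivity (z ^+ 3 - 1); first by ring.
  by rewrite (prim_expr_order prim_z) subrr.
(* The cube root of unity lives in [algC], into which the integers embed. *)
apply: (@fps_map_inj _ _ (intr : int -> algC)); first exact: intr_inj.
rewrite !(rmorphXn, rmorphM, rmorphB) /= rmorph_nat fps_mapX !eulerE_map.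
exact: (eulerE_cubic_relation z0).
Qed.

(** * Eta quotients of level 12 *)

Section SignTwist.
Variable R : comNzRingType.
Local Notation X := (fpsX R).
Local Notation E := (eulerE R).

(** Odd exponents pair as (1 + z^k)(1 - z^k) = 1 - z^(2k); for even exponents the two factors
    coincide. *)
Lemma qfact_sign (S : comNzRingType) (z : S) M :
  qfact (- z) (2 * M) * qfact z (2 * M) * qfact (z ^+ 4) M =
  qfact (z ^+ 2) (2 * M) * qfact (z ^+ 2) M ^+ 2.
Proof.
elim: M => [|M IH]; first by rewrite !muln0 /qfact !big_ord0; ring.
have e : (2 * M.+1 = (2 * M).+2)%N by lia.
have pw a b k : (a * b = k)%N -> (z ^+ a) ^+ b = z ^+ k by move=> <-; rewrite exprM.
rewrite e !qfactS.
set A := qfact (- z) _ in IH *; set B := qfact z _ in IH *.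
set C := qfact (z ^+ 4) _ in IH *; set D := qfact (z ^+ 2) _ in IH *.
set G := qfact (z ^+ 2) M in IH *.
rewrite !(exprNn z) -(signr_odd _ (2 * M).+1) -(signr_odd _ (2 * M).+2) /= oddM /=.
rewrite (pw 4 _ ((2 * M).+2 * 2)%N); last by lia.
rewrite (pw 2 (2 * M).+1 ((2 * M).+1 * 2)%N); last by lia.
rewrite (pw 2 (2 * M).+2 ((2 * M).+2 * 2)%N); last by lia.
rewrite (pw 2 M.+1 (2 * M).+2); last by lia.
rewrite !exprM.
transitivity (A * B * C * (1 - z ^+ (2 * M).+1 ^+ 2) * (1 - z ^+ (2 * M).+2) ^+ 2 *
  (1 - z ^+ (2 * M).+2 ^+ 2)); first by ring.
by rewrite IH; ring.
Qed.

Lemma eulerE_sign1 : fps_twist (-1) (E 1) * E 1 * E 4 = E 2 ^+ 3.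
Proof.
apply: fps_eqmodP => N; apply: (@fps_eqmod_le _ _ N.+1) => //.
have lim a M : (0 < a)%N -> (N <= M)%N -> fps_eqmod N.+1 (qfact (X ^+ a) M) (E a).
  by move=> a0 le; apply/fps_eqmod_sym/(fps_eqmod_le _ (eulerE_eqmod _ a0)).
have tw M : fps_twist (-1) (qfact X M) = qfact (- X) M.
  rewrite /qfact rmorph_prod; apply: eq_bigr => i _.
  by rewrite rmorphB rmorph1 rmorphXn /= fps_twistX rmorphN1 mulN1r.
have lim1 : fps_eqmod N.+1 (qfact X (2 * N)) (E 1).
  by rewrite -{1}[X]expr1; apply: lim => //; lia.
apply: (fps_eqmod_trans
  (fps_twist (-1) (qfact X (2 * N)) * qfact X (2 * N) * qfact (X ^+ 4) N)).
  apply/fps_eqmod_sym/fps_eqmodM; last exact: lim.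
  by apply: fps_eqmodM => //; apply: fps_eqmod_twist.
rewrite tw qfact_sign [E 2 ^+ 3]exprS; apply: fps_eqmodM; first by apply: lim => //; lia.
by apply: fps_eqmodX; apply: lim.
Qed.

Lemma eulerE_sign3 : fps_twist (-1) (E 3) * E 3 * E 12 = E 6 ^+ 3.
Proof.
have s a : (0 < a)%N -> E (a * 3) = fps_subst 2 (E a) by move=> a0; rewrite eulerE_subst.
rewrite (s 1%N) // (s 4%N) // (s 2%N) // fps_twist_subst -signr_odd /= expr1.
by rewrite -[RHS]rmorphXn -eulerE_sign1 !rmorphM.
Qed.

Lemma eulerE_sign_even a : (0 < a)%N -> fps_twist (-1) (E (a * 2)) = E (a * 2).
Proof.
by move=> a0; rewrite -(eulerE_subst _ 1) // fps_twist_subst -signr_odd expr0 fps_twist1.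
Qed.

Lemma eulerEinv_subst r a :
  (0 < a)%N -> fps_subst r (eulerEinv R a) = eulerEinv R (a * r.+1).
Proof.
move=> a0; have ar0 : (0 < a * r.+1)%N by rewrite muln_gt0 a0.
rewrite -[LHS]mulr1 -(eulerE_mulV R ar0) -eulerE_subst // mulrA -rmorphM.
by rewrite [_ * E a]mulrC eulerE_mulV // rmorph1 mul1r.
Qed.
End SignTwist.

Local Notation S := (fps int).
Local Notation E := (eulerE int).
Local Notation I := (eulerEinv int).
Local Notation X := (fpsX int).
Local Notation V := (@fps_subst int 1).
Local Notation sg := (@fps_twist int (-1)).

(* Locked so that morphism lemmas do not rewrite inside them.  In the end
   aq = 1 + t, bq = 1 - t, cq = 1 + 3 t, dq = 1 - 3 t with t = tq, and Tq is
   1 - 1/xi, whose image under V is t^2. *)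
HB.lock Definition tq : S := X * E 2 ^+ 2 * E 12 ^+ 4 * I 4 ^+ 4 * I 6 ^+ 2.
HB.lock Definition aq : S := E 3 ^+ 3 * E 2 ^+ 2 * E 12 * I 1 * I 4 ^+ 3 * I 6 ^+ 2.
HB.lock Definition bq : S := E 6 ^+ 7 * E 1 * I 3 ^+ 3 * I 12 ^+ 2 * I 2 * I 4 ^+ 2.
HB.lock Definition cq : S := E 2 ^+ 9 * E 3 * E 12 ^+ 2 * I 1 ^+ 3 * I 4 ^+ 6 * I 6 ^+ 3.
HB.lock Definition dq : S := E 1 ^+ 3 * E 12 * I 3 * I 4 ^+ 3.
HB.lock Definition xi_inv : S := E 1 * E 3 ^+ 5 * I 2 ^+ 5 * I 6.
HB.lock Definition xi : S := E 2 ^+ 5 * E 6 * (I 1 * I 3 ^+ 5).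
HB.lock Definition Tq : S := X * E 1 ^+ 4 * E 6 ^+ 8 * I 2 ^+ 8 * I 3 ^+ 4.
HB.lock Definition uq : S := E 1 * E 2 * E 6 * I 3 ^+ 3.
HB.lock Definition sq : S := E 1 ^+ 3 * E 6 * I 2 ^+ 3 * I 3.
HB.lock Definition pdo : S := E 4 * E 6 ^+ 2 * (I 1 * (I 3 * I 12)).

(* Kept opaque because [field] does not terminate on the concrete fraction field. *)
Fact fps_fraction_field : {F : fieldType & {f : {rmorphism S -> F} | injective f}}.
Proof.
exists {fraction S}, (@tofrac S : {rmorphism S -> {fraction S}}) => f g /= e.
by apply/eqP; rewrite -tofrac_eq e.
Qed.

Definition fps_frac : {rmorphism S -> projT1 fps_fraction_field} :=
  sval (projT2 fps_fraction_field).
Lemma fps_frac_inj : injective fps_frac.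
Proof. exact: svalP (projT2 fps_fraction_field). Qed.

Lemma frac_eulerE_neq0 a : fps_frac (E a) != 0.
Proof. by rewrite -(rmorph0 fps_frac) (inj_eq fps_frac_inj) eulerE_neq0. Qed.

Lemma frac_eulerEinv a : (0 < a)%N -> fps_frac (I a) = (fps_frac (E a))^-1.
Proof.
move=> a0; apply: (mulfI (frac_eulerE_neq0 a)).
by rewrite mulfV ?frac_eulerE_neq0 // -rmorphM eulerE_mulV // rmorph1.
Qed.

(** Identities between eta quotients are monomial identities, checked in the fraction field with the
    Euler products generalized to arbitrary nonzero elements. *)
Local Ltac eta_field :=
  apply: fps_frac_inj; rewrite !(rmorphXn, rmorphM, rmorph1) ?frac_eulerEinv //;
  have := (frac_eulerE_neq0 1, frac_eulerE_neq0 2, frac_eulerE_neq0 3,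
           frac_eulerE_neq0 4, frac_eulerE_neq0 6, frac_eulerE_neq0 12);
  move: (fps_frac (E 1)) (fps_frac (E 2)) (fps_frac (E 3));
  move: (fps_frac (E 4)) (fps_frac (E 6)) (fps_frac (E 12)) (fps_frac X);
  move=> ? ? ? ? ? ? ? [[[[[? ?] ?] ?] ?] ?];
  field; do ?[apply/andP; split]; assumption.

Lemma xi_inv_c : xi_inv * cq = aq ^+ 2.
Proof. by rewrite xi_inv.unlock cq.unlock aq.unlock; eta_field. Qed.
Lemma xi_xi_inv : xi * xi_inv = 1.
Proof. by rewrite xi_inv.unlock xi.unlock; eta_field. Qed.
Lemma T_c : Tq * cq = tq * bq.
Proof. by rewrite Tq.unlock cq.unlock tq.unlock bq.unlock; eta_field. Qed.
Lemma u_a : uq * aq = E 2 ^+ 3 * E 12 * I 4 ^+ 3 * I 6.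
Proof. by rewrite uq.unlock aq.unlock; eta_field. Qed.
Lemma s_xi : sq * xi = uq ^+ 2.
Proof. by rewrite sq.unlock xi.unlock uq.unlock; eta_field. Qed.
Lemma s3_c : sq ^+ 3 * cq = dq ^+ 2.
Proof. by rewrite sq.unlock cq.unlock dq.unlock; eta_field. Qed.
Lemma xi_inv_subst : E 2 * E 6 ^+ 5 * I 4 ^+ 5 * I 12 = aq * bq.
Proof. by rewrite aq.unlock bq.unlock; eta_field. Qed.
Lemma T_subst : X ^+ 2 * E 2 ^+ 4 * E 12 ^+ 8 * I 4 ^+ 8 * I 6 ^+ 4 = tq ^+ 2.
Proof. by rewrite tq.unlock; eta_field. Qed.
Lemma s3_subst : (E 2 ^+ 3 * E 12 * I 4 ^+ 3 * I 6) ^+ 3 = cq * dq.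
Proof. by rewrite cq.unlock dq.unlock; eta_field. Qed.
Lemma pdo2_d : pdo ^+ 2 * dq = E 2 * E 4 * E 12 * I 6 ^+ 3 * bq.
Proof. by rewrite pdo.unlock dq.unlock bq.unlock; eta_field. Qed.

(** The common factor that turns the three terms of [eulerE_relation] into d^2, a^2 and 8 t b.
    [cofactor2] does the same after q -> q^2, giving c d, a b and 8 t^2. *)
Local Definition cofactor1 : S := E 12 ^+ 2 * I 1 ^+ 2 * I 3 ^+ 3 * I 4 ^+ 6 * I 6 ^+ 4.
Lemma d2E : dq ^+ 2 = E 1 ^+ 8 * E 6 ^+ 4 * E 3 * cofactor1.
Proof. by rewrite dq.unlock /cofactor1; eta_field. Qed.
Lemma a2E : aq ^+ 2 = E 2 ^+ 4 * E 3 ^+ 9 * cofactor1.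
Proof. by rewrite aq.unlock /cofactor1; eta_field. Qed.
Lemma tbE : tq * bq = X * E 2 * E 1 ^+ 3 * E 6 ^+ 9 * cofactor1.
Proof. by rewrite tq.unlock bq.unlock /cofactor1; eta_field. Qed.
Local Definition cofactor2 : S := E 2 * I 4 ^+ 9 * I 6 ^+ 4 * I 12.
Lemma cdE : cq * dq = E 2 ^+ 8 * E 12 ^+ 4 * E 6 * cofactor2.
Proof. by rewrite cq.unlock dq.unlock /cofactor2; eta_field. Qed.
Lemma abE : aq * bq = E 4 ^+ 4 * E 6 ^+ 9 * cofactor2.
Proof. by rewrite aq.unlock bq.unlock /cofactor2; eta_field. Qed.
Lemma t2E : tq ^+ 2 = X ^+ 2 * E 4 * E 2 ^+ 3 * E 12 ^+ 9 * cofactor2.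
Proof. by rewrite tq.unlock /cofactor2; eta_field. Qed.

Lemma fps_twist_unit1 : sg (E 1) = E 2 ^+ 3 * I 1 * I 4.
Proof.
rewrite -eulerE_sign1; transitivity (sg (E 1) * (E 1 * I 1) * (E 4 * I 4)); last by ring.
by rewrite !eulerE_mulV // !mulr1.
Qed.
Lemma fps_twist_unit3 : sg (E 3) = E 6 ^+ 3 * I 3 * I 12.
Proof.
rewrite -eulerE_sign3; transitivity (sg (E 3) * (E 3 * I 3) * (E 12 * I 12)); last by ring.
by rewrite !eulerE_mulV // !mulr1.
Qed.
Lemma fps_twist_inv (f g h k : S) : f * g = 1 -> sg f = h -> h * k = 1 -> sg g = k.
Proof.
move=> fg <- hk; rewrite -[LHS]mulr1 -hk mulrA -rmorphM [g * f]mulrC fg.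
by rewrite rmorph1 mul1r.
Qed.
Lemma fps_twist_inv1 : sg (I 1) = E 1 * E 4 * I 2 ^+ 3.
Proof. by apply: (fps_twist_inv _ fps_twist_unit1); [exact: eulerE_mulV | eta_field]. Qed.
Lemma fps_twist_inv3 : sg (I 3) = E 3 * E 12 * I 6 ^+ 3.
Proof. by apply: (fps_twist_inv _ fps_twist_unit3); [exact: eulerE_mulV | eta_field]. Qed.
Lemma fps_twist_even a : (0 < a)%N -> sg (E (a * 2)) = E (a * 2) /\ sg (I (a * 2)) = I (a * 2).
Proof.
move=> a0; have a2 : (0 < a * 2)%N by lia.
have e : sg (E (a * 2)) = E (a * 2) by apply: eulerE_sign_even.
by split=> //; apply: (fps_twist_inv _ e); apply: eulerE_mulV.
Qed.
Definition fps_twistE := (fps_twist_unit1, fps_twist_unit3, fps_twist_inv1, fps_twist_inv3,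
  (fps_twist_even (isT : (0 < 1)%N)).1, (fps_twist_even (isT : (0 < 2)%N)).1,
  (fps_twist_even (isT : (0 < 3)%N)).1, (fps_twist_even (isT : (0 < 6)%N)).1,
  (fps_twist_even (isT : (0 < 1)%N)).2, (fps_twist_even (isT : (0 < 2)%N)).2,
  (fps_twist_even (isT : (0 < 3)%N)).2, (fps_twist_even (isT : (0 < 6)%N)).2).

Lemma sg_X : sg X = - X.
Proof. by rewrite fps_twistX rmorphN1 mulN1r. Qed.
Local Ltac sg_field := rewrite !(rmorphXn, rmorphM) /= ?sg_X ?fps_twistE; eta_field.

Lemma sg_a : sg aq = bq.
Proof. by rewrite aq.unlock bq.unlock; sg_field. Qed.
Lemma sg_b : sg bq = aq.
Proof. by rewrite aq.unlock bq.unlock; sg_field. Qed.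
Lemma sg_d : sg dq = cq.
Proof. by rewrite dq.unlock cq.unlock; sg_field. Qed.
Lemma sg_t : sg tq = - tq.
Proof.
rewrite tq.unlock !(rmorphXn, rmorphM) /= sg_X.
by rewrite !fps_twistE; ring.
Qed.
(** The eta quotient in parentheses is V s. This evaluates the cross term in the square of D(q) +
    D(-q). *)
Lemma pdo_sg : pdo * sg pdo * (E 2 ^+ 3 * E 12 * I 4 ^+ 3 * I 6) = 1.
Proof. by rewrite pdo.unlock; sg_field. Qed.

Lemma subst_xi_inv : V xi_inv = aq * bq.
Proof.
rewrite xi_inv.unlock !(rmorphXn, rmorphM) /= !eulerE_subst // !eulerEinv_subst //.
exact: xi_inv_subst.
Qed.
Lemma subst_T : V Tq = tq ^+ 2.
Proof.
rewrite Tq.unlock !(rmorphXn, rmorphM) /= fps_substX !eulerE_subst // !eulerEinv_subst //.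
exact: T_subst.
Qed.
Lemma subst_s : V sq = E 2 ^+ 3 * E 12 * I 4 ^+ 3 * I 6.
Proof. by rewrite sq.unlock !(rmorphXn, rmorphM) /= !eulerE_subst // !eulerEinv_subst. Qed.
Lemma subst_u : V uq = E 2 * E 4 * E 12 * I 6 ^+ 3.
Proof. by rewrite uq.unlock !(rmorphXn, rmorphM) /= !eulerE_subst // !eulerEinv_subst. Qed.

(** * Parametrization by the level 12 Hauptmodul *)

Lemma fps_const_neq0 (f : S) : fps_const f != 0 -> f != 0.
Proof. by apply: contra_neq => ->; rewrite rmorph0. Qed.

Lemma const_E a : fps_const (E a) = 1. Proof. exact: eulerE_const. Qed.
Lemma const_I a : fps_const (I a) = 1. Proof. exact: eulerEinv_const. Qed.
Lemma const_X : fps_const X = 0. Proof. exact: coefX. Qed.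

Local Ltac const_eval := rewrite !(rmorphXn, rmorphM) /= ?const_E ?const_I ?const_X ?expr1n
  ?mulr1 ?mul0r.

Lemma const_t : fps_const tq = 0. Proof. by rewrite tq.unlock; const_eval. Qed.
Lemma const_a : fps_const aq = 1. Proof. by rewrite aq.unlock; const_eval. Qed.
Lemma const_b : fps_const bq = 1. Proof. by rewrite bq.unlock; const_eval. Qed.
Lemma const_c : fps_const cq = 1. Proof. by rewrite cq.unlock; const_eval. Qed.
Lemma const_d : fps_const dq = 1. Proof. by rewrite dq.unlock; const_eval. Qed.
Lemma const_xi : fps_const xi = 1. Proof. by rewrite xi.unlock; const_eval. Qed.
Lemma const_s : fps_const sq = 1. Proof. by rewrite sq.unlock; const_eval. Qed.
Lemma const_pdo : fps_const pdo = 1. Proof. by rewrite pdo.unlock; const_eval. Qed.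

Lemma tq_neq0 : tq != 0.
Proof.
rewrite -(inj_eq fps_frac_inj) rmorph0 tq.unlock !(rmorphXn, rmorphM) !frac_eulerEinv //.
rewrite !mulf_neq0 ?expf_neq0 ?invr_neq0 ?frac_eulerE_neq0 //.
by rewrite -(rmorph0 fps_frac) (inj_eq fps_frac_inj) fpsX_neq0.
Qed.

Lemma relation_d2 : dq ^+ 2 = aq ^+ 2 - 8 * tq * bq.
Proof. by rewrite d2E a2E -[8 * tq * bq]mulrA tbE eulerE_relation; ring. Qed.

Lemma relation_c2 : cq ^+ 2 = bq ^+ 2 + 8 * tq * aq.
Proof.
have := congr1 sg relation_d2.
rewrite !(rmorphXn, rmorphB, rmorphM) /= rmorph_nat sg_a sg_b sg_d sg_t => ->; ring.
Qed.

Lemma relation_cd : cq * dq = aq * bq - 8 * tq ^+ 2.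
Proof.
rewrite cdE abE t2E; have := congr1 V eulerE_relation.
rewrite !(rmorphXn, rmorphB, rmorphM) /= rmorph_nat fps_substX !eulerE_subst //.
rewrite -[(1 * 2)%N]/2%N -[(2 * 2)%N]/4%N -[(3 * 2)%N]/6%N -[(6 * 2)%N]/12%N => ->; ring.
Qed.

(** Selects the branch of a factored equation: the constant term excludes the other factor. *)
Lemma factor_out (f g : S) : f * g = 0 -> fps_const g != 0 -> f = 0.
Proof.
move=> /eqP; rewrite mulf_eq0 => /orP[/eqP //|/eqP ->]; by rewrite rmorph0 eqxx.
Qed.

Local Ltac const_calc := rewrite !(rmorphD, rmorphB, rmorphN, rmorphXn, rmorphM) /=
  ?rmorph1 ?const_a ?const_b ?const_c ?const_d ?const_t.

(* With x = a, y = -b, z = -2 t, the relations for c^2, d^2 and cd combine to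
   x^3 + y^3 + z^3 = 3 x y z, which has the factor x + y + z. *)
Lemma relation_ab : aq - bq = 2 * tq.
Proof.
apply/eqP; rewrite -subr_eq0; apply/eqP.
apply: (@factor_out _
  (aq ^+ 2 + bq ^+ 2 + 4 * tq ^+ 2 + aq * bq - 2 * tq * bq + 2 * tq * aq)); last by const_calc.
have t8 : 8 * tq != 0.
  rewrite mulf_neq0 ?tq_neq0 //; apply: fps_const_neq0; by rewrite rmorph_nat.
apply: (mulfI t8); rewrite mulr0.
transitivity ((bq ^+ 2 + 8 * tq * aq) * (aq ^+ 2 - 8 * tq * bq) -
  (aq * bq - 8 * tq ^+ 2) ^+ 2).
  ring.
by rewrite -relation_cd -relation_c2 -relation_d2; ring.
Qed.

(** With 2 t = a - b, the right side of [relation_c2] is the square of 2 a - b; constant terms fix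
    the sign. *)
Lemma relation_c : cq = 2 * aq - bq.
Proof.
apply/eqP; rewrite -subr_eq0; apply/eqP.
apply: (@factor_out _ (cq + (2 * aq - bq))); last by const_calc.
transitivity (cq ^+ 2 - (bq ^+ 2 + 4 * (aq - bq) * aq)); first by ring.
by rewrite relation_c2 relation_ab; ring.
Qed.

Lemma relation_d : dq = 2 * bq - aq.
Proof.
apply/eqP; rewrite -subr_eq0; apply/eqP.
apply: (@factor_out _ (dq + (2 * bq - aq))); last by const_calc.
transitivity (dq ^+ 2 - (aq ^+ 2 - 4 * (aq - bq) * bq)); first by ring.
by rewrite relation_d2 relation_ab; ring.
Qed.

(** If f - 1 has finite order k, then k > 0 and V (f - 1) has order 2k. But it equals (f - 1)(f +
    1), of order k, since f + 1 has constant term 2. *)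
Lemma subst_sqr_eq1 (f : S) : fps_const f = 1 -> V f = f ^+ 2 -> f = 1.
Proof.
move=> f0 e; suff g0 : f - 1 = 0 by rewrite -[f](subrK 1) g0 add0r.
apply/eqP/contraT => /fps_neq0P[[g k] /= gE g00].
have Vg : V (f - 1) = (f - 1) * (f + 1) by rewrite rmorphB rmorph1 /= e; ring.
have k0 : (0 < k)%N.
  case: k gE => // gE; move/eqP: g00; case.
  have := congr1 (@fps_const int) gE; rewrite rmorphB rmorph1 /= f0 subrr expr0 mul1r.
  by move->.
move: Vg; rewrite {1 2}gE rmorphM rmorphXn /= fps_substX -exprM => h.
have : fpsX int ^+ k * (fpsX int ^+ k * V g) = fpsX int ^+ k * (g * (f + 1)).
  by rewrite !mulrA -h -exprD; congr (_ ^+ _ * _); lia.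
move/fpsX_reg/(congr1 (@fps_const int)); rewrite !rmorphM rmorphXn rmorphD rmorph1 /= f0 const_X.
rewrite expr0n gtn_eqF // mul0r => /esym/eqP; rewrite mulf_eq0.
by rewrite [fps_const g](erefl (g 0%N)) (negbTE g00).
Qed.

Lemma cq_neq0 : cq != 0. Proof. by apply: fps_const_neq0; rewrite const_c. Qed.

Lemma xi_inv_T : xi_inv + Tq = aq - tq.
Proof.
have c0 := cq_neq0; apply: (mulIf c0); rewrite mulrDl xi_inv_c T_c relation_c.
have -> : bq = aq - 2 * tq by rewrite -relation_ab; ring.
ring.
Qed.

(* Homogenizing, e = a - t satisfies V e = e^2, which forces e = 1. *)
Lemma aqE : aq = 1 + tq.
Proof.
suff e : aq - tq = 1 by rewrite -e subrK.
apply: subst_sqr_eq1; first by rewrite rmorphB /= const_a const_t subr0.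
rewrite -{1}xi_inv_T rmorphD /= subst_xi_inv subst_T.
have -> : bq = aq - 2 * tq by rewrite -relation_ab; ring.
ring.
Qed.

Lemma bqE : bq = 1 - tq.
Proof. have -> : bq = aq - 2 * tq by rewrite -relation_ab; ring. by rewrite aqE; ring. Qed.
Lemma cqE : cq = 1 + 3 * tq. Proof. by rewrite relation_c aqE bqE; ring. Qed.
Lemma dqE : dq = 1 - 3 * tq. Proof. by rewrite relation_d aqE bqE; ring. Qed.

Lemma xi_T : xi * Tq = xi - 1.
Proof.
have -> : Tq = 1 - xi_inv.
  have -> : 1 = aq - tq by rewrite aqE; ring.
  by rewrite -xi_inv_T; ring.
by rewrite mulrBr mulr1 xi_xi_inv.
Qed.

Lemma xi_a : xi * (1 + tq) ^+ 2 = 1 + 3 * tq.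
Proof. by rewrite -aqE -xi_inv_c mulrA xi_xi_inv mul1r cqE. Qed.

Lemma subst_s_u : V sq = uq * (1 + tq).
Proof. by rewrite -aqE u_a subst_s. Qed.

Lemma subst_s3 : V sq ^+ 3 = (1 + 3 * tq) * (1 - 3 * tq).
Proof. by rewrite -cqE -dqE subst_s s3_subst. Qed.

(** V T = t^2 gives s^3 = 1 - 9 T; then u^2 = s xi and xi T = xi - 1. This relation converts powers
    of u into powers of xi. *)
Lemma u6 : uq ^+ 6 = xi ^+ 2 * (9 - 8 * xi).
Proof.
have s3 : sq ^+ 3 = 1 - 9 * Tq.
  apply: (@fps_subst_inj _ 1); rewrite rmorphXn /= subst_s3.
  by rewrite rmorphB rmorph1 rmorphM rmorph_nat /= subst_T; ring.
have -> : uq ^+ 6 = (uq ^+ 2) ^+ 3 by rewrite -exprM.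
rewrite -s_xi exprMn s3.
transitivity (xi ^+ 2 * (xi - 9 * (xi * Tq))); first by ring.
by rewrite xi_T; ring.
Qed.

(** * The even-part operator U and the identity U D = D^2 *)

Definition fpsU (f : S) : S := fun n => f (2 * n)%N.

Lemma fps_even_odd (f : S) : f = V (fpsU f) + X * V (fun n => f (2 * n).+1).
Proof.
apply: fpsP => n; rewrite fpsD -[X]expr1 fpsXnM /fps_subst /fpsU.
case: (boolP (2 %| n)%N) => [/dvdnP[m ->]|nd].
  rewrite mulnK // mulnC; case: ltnP => [_|m0]; first by rewrite addr0.
  by case: ifP => [|_]; rewrite ?addr0 //; lia.
have n0 : (1 <= n)%N by lia.
rewrite ltnNge n0 /=; case: ifP => [_|]; last by lia.
by rewrite add0r; congr f; lia.
Qed.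

Lemma fpsU_subst f : fpsU (V f) = f.
Proof. by apply: fpsP => n; rewrite /fpsU /fps_subst dvdn_mulr // mulKn. Qed.

Lemma fpsU_substM g f : fpsU (V g * f) = g * fpsU f.
Proof.
pose h : S := fun n => f (2 * n).+1.
have -> : V g * f = V (g * fpsU f) + X * V (g * h).
  by rewrite {1}[f]fps_even_odd -/h !rmorphM; ring.
apply: fpsP => n; rewrite /fpsU fpsD -[X]expr1 fpsXnM.
rewrite -[V _ (2 * n)%N]/(fpsU (V _) n) fpsU_subst.
case: ltnP => [_|n0]; first by rewrite addr0.
by rewrite /fps_subst; case: ifP => [|_]; rewrite ?addr0 //; lia.
Qed.

Lemma fpsUD f g : fpsU (f + g) = fpsU f + fpsU g. Proof. by []. Qed.

Lemma fpsU_odd f : sg f = - f -> fpsU f = 0.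
Proof.
move=> e; apply: fpsP => n; have := congr1 (fun h : S => h (2 * n)%N) e.
rewrite /fpsU fps0 fpsN /fps_twist exprM sqrrN !expr1n mul1r; lia.
Qed.

Lemma subst_fpsU f : 2 * V (fpsU f) = f + sg f.
Proof.
have sgV h : sg (V h) = V h by rewrite fps_twist_subst sqrrN expr1n fps_twist1.
rewrite {2 3}[f]fps_even_odd rmorphD rmorphM /= !sgV sg_X; ring.
Qed.

(** Evaluates D^4, hence the square of the right side of [fpsU_pdo]. It comes from squaring D^2 d =
    V u b, with (V u)^2 a b = V s and s^3 c = d^2. *)
Lemma pdo4 : 2 * pdo ^+ 4 * sq ^+ 3 = uq * (1 - 3 * Tq) + sq ^+ 2.
Proof.
have s_c : sq * cq = V sq ^+ 2.
  rewrite subst_s_u -aqE exprMn -xi_inv_c -s_xi.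
  by rewrite -[in LHS](mul1r cq) -xi_xi_inv; ring.
have Vu2 : V uq ^+ 2 * (aq * bq) = V sq.
  rewrite -subst_xi_inv -rmorphXn -rmorphM /= -s_xi.
  by rewrite -mulrA xi_xi_inv mulr1.
have d4 : pdo ^+ 4 * dq ^+ 2 * aq = V sq * bq.
  have b0 : bq != 0 by apply: fps_const_neq0; rewrite const_b.
  apply: (mulIf b0); transitivity ((pdo ^+ 2 * dq) ^+ 2 * (aq * bq)); first by ring.
  by rewrite pdo2_d -subst_u -Vu2; ring.
have ca0 : cq ^+ 2 * aq != 0.
  rewrite mulf_neq0 ?expf_neq0 ?cq_neq0 //.
  by apply: fps_const_neq0; rewrite const_a.
apply: (mulIf ca0).
transitivity (2 * (pdo ^+ 4 * (sq ^+ 3 * cq) * aq) * cq); first by ring.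
rewrite s3_c d4.
transitivity ((uq * (1 + tq)) * cq * (cq - 3 * (Tq * cq)) + (sq * cq) ^+ 2 * aq); last first.
  by rewrite aqE; ring.
rewrite -subst_s_u T_c s_c.
have -> : (V sq ^+ 2) ^+ 2 = V sq * V sq ^+ 3 by ring.
by rewrite subst_s3 aqE bqE cqE; ring.
Qed.

(* Both sides are determined by their squares, D being a square root in Z[[q]]
   of an element of the field generated by t and V u. *)
Lemma fpsU_pdo : fpsU pdo = pdo ^+ 2.
Proof.
have Vs0 : V sq ^+ 3 != 0.
  by rewrite expf_neq0 // -(rmorph0 V) (inj_eq (@fps_subst_inj _ 1)) fps_const_neq0 // const_s.
have d2 := pdo2_d; rewrite -subst_u in d2.
have sg_u : sg (V uq) = V uq by rewrite fps_twist_subst sqrrN expr1n fps_twist1.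
have c2 : sg pdo ^+ 2 * cq = V uq * aq.
  by have := congr1 sg d2; rewrite !(rmorphXn, rmorphM) /= sg_d sg_b sg_u.
have dc := pdo_sg; rewrite -subst_s in dc.
have e2 : (pdo + sg pdo) ^+ 2 = (2 * V (pdo ^+ 2)) ^+ 2.
  apply: (mulIf Vs0).
  transitivity (2 * V (2 * pdo ^+ 4 * sq ^+ 3)); last first.
    by rewrite !(rmorphXn, rmorphM) /= rmorph_nat; ring.
  rewrite pdo4 !(rmorph_nat, rmorph1, rmorphXn, rmorphM, rmorphB, rmorphD) /= subst_T.
  transitivity (pdo ^+ 2 * V sq ^+ 3 + sg pdo ^+ 2 * V sq ^+ 3 +
     2 * (pdo * sg pdo * V sq) * V sq ^+ 2); first by ring.
  rewrite dc subst_s3 -cqE -dqE.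
  transitivity ((pdo ^+ 2 * dq) * cq + (sg pdo ^+ 2 * cq) * dq + 2 * V sq ^+ 2); first by ring.
  by rewrite d2 c2 aqE bqE cqE dqE; ring.
apply: (@fps_subst_inj _ 1).
have n2 : (2 : S) != 0 by apply: fps_const_neq0; rewrite rmorph_nat.
apply: (mulfI n2); rewrite subst_fpsU.
apply/eqP; rewrite -subr_eq0; apply/eqP.
(* Equal squares leave a sign open; the sum has constant term 4, so the difference vanishes. *)
apply: (@factor_out _ (pdo + sg pdo + 2 * V (pdo ^+ 2))).
  transitivity ((pdo + sg pdo) ^+ 2 - (2 * V (pdo ^+ 2)) ^+ 2); first by ring.
  by rewrite e2 subrr.
have cV f : fps_const (V f) = fps_const f by exact: fps_subst_const.
have csg f : fps_const (sg f) = fps_const f by exact: fps_twist_const.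
by rewrite !(rmorph_nat, rmorphXn, rmorphD, rmorphM) /= !cV csg const_pdo.
Qed.

Lemma pdo2E : pdo ^+ 2 * (1 - 3 * tq) = V uq * (1 - tq).
Proof. by rewrite -dqE -bqE subst_u pdo2_d. Qed.

(** * Iterating the even-part operator *)

Definition ev (s : S) (Q : {poly int}) : S := (map_poly intr Q).[s].

Fact ev_zmod s : zmod_morphism (ev s).
Proof. by move=> p q; rewrite /ev rmorphB hornerD hornerN. Qed.
Fact ev_monoid s : monoid_morphism (ev s).
Proof.
by split=> [|p q]; rewrite /ev ?rmorph1 ?hornerC // rmorphM hornerM.
Qed.
HB.instance Definition _ s :=
  GRing.isZmodMorphism.Build {poly int} S (ev s) (ev_zmod s).
HB.instance Definition _ s :=
  GRing.isMonoidMorphism.Build {poly int} S (ev s) (ev_monoid s).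

Lemma evX s : ev s 'X = s. Proof. by rewrite /ev map_polyX hornerX. Qed.
Lemma evC s c : ev s c%:P = c%:~R. Proof. by rewrite /ev map_polyC hornerC. Qed.
Lemma evZ s c Q : ev s (c *: Q) = c%:~R * ev s Q.
Proof. by rewrite -mul_polyC rmorphM /= evC. Qed.
Lemma ev_wide n s (Q : {poly int}) : (size Q <= n)%N ->
  ev s Q = \sum_(i < n) (Q`_i)%:~R * s ^+ i.
Proof.
move=> le; rewrite /ev (@horner_coef_wide _ n); last first.
  exact: leq_trans (size_poly _ _) le.
by apply: eq_bigr => i _; rewrite coef_map.
Qed.
Lemma ev_comp s (A B : {poly int}) : ev s (A \Po B) = ev (ev s B) A.
Proof. by rewrite /ev map_comp_poly horner_comp. Qed.

Lemma const_ev s (Q : {poly int}) : fps_const (ev s Q) = Q.[fps_const s].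
Proof.
rewrite /ev -horner_map -map_poly_comp; congr (_.[_]).
by apply: map_poly_id => c _ /=; rewrite rmorph_int intz.
Qed.

(* Clears the denominator w from w ^+ K * Q(x), where A = w x and B = w. *)
Definition homog K (A B Q : {poly int}) : {poly int} :=
  \sum_(i < K.+1) Q`_i *: (A ^+ i * B ^+ (K - i)).

Lemma ev_homog K (A B Q : {poly int}) s w x : (size Q <= K.+1)%N ->
  w * x = ev s A -> w = ev s B -> ev s (homog K A B Q) = w ^+ K * ev x Q.
Proof.
move=> le eA eB; rewrite (ev_wide x le) big_distrr rmorph_sum; apply: eq_bigr => -[i lti] _ /=.
rewrite evZ rmorphM !rmorphXn /= -eA -eB exprMn.
by rewrite -[in RHS](@subnK i K) // exprD; ring.
Qed.

Lemma size_homog K (A B Q : {poly int}) d : (size A <= d.+1)%N -> (size B <= d.+1)%N ->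
  (size (homog K A B Q) <= (d * K).+1)%N.
Proof.
move=> sA sB; apply: leq_trans (size_sum _ _ _) _; apply/bigmax_leqP => -[i lti] _ /=.
apply: leq_trans (size_scale_leq _ _) _; apply: leq_trans (size_polyMleq _ _) _.
have := size_poly_exp_leq A i; have := size_poly_exp_leq B (K - i).
move: (size (A ^+ i)) (size (B ^+ (K - i))) => a b hb ha.
have h1 : ((size A).-1 * i <= d * i)%N by rewrite leq_mul2r; lia.
have h2 : ((size B).-1 * (K - i) <= d * (K - i))%N by rewrite leq_mul2r; lia.
have h3 : (d * i + d * (K - i) = d * K)%N by rewrite -mulnDr subnKC.
lia.
Qed.

(** Even powers of t are powers of V T, which pass through U; odd powers are odd series, which U
    kills. So U halves the degree. *)
Lemma fpsU_ev g (Q : {poly int}) m : (size Q <= m.*2)%N ->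
  exists2 Q' : {poly int}, (size Q' <= m)%N & fpsU (V g * ev tq Q) = g * ev Tq Q'.
Proof.
move=> le; exists (even_poly Q).
  by apply: leq_trans (size_even_poly _) _; lia.
rewrite -{1}(poly_even_odd Q) rmorphD rmorphM /= !ev_comp rmorphXn /= !evX -subst_T.
have Vev h : ev (V Tq) h = V (ev Tq h).
  rewrite !(ev_wide _ (leqnn _)) rmorph_sum; apply: eq_bigr => i _.
  by rewrite rmorphM rmorphXn rmorph_int.
by rewrite !Vev mulrDr fpsUD mulrA -!rmorphM fpsU_subst fpsU_substM (fpsU_odd sg_t) mulr0 addr0.
Qed.

Lemma xi_1T : xi * (1 - Tq) = 1.
Proof. by rewrite mulrBr mulr1 xi_T; ring. Qed.
Lemma xi_9T : xi * (1 - 9 * Tq) = 9 - 8 * xi.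
Proof. by transitivity (xi - 9 * (xi * Tq)); [|rewrite xi_T]; ring. Qed.
Lemma subst_1T : V (1 - Tq) = (1 + tq) * (1 - tq).
Proof. by rewrite rmorphB rmorph1 /= subst_T; ring. Qed.
Lemma subst_9T : V (1 - 9 * Tq) = (1 + 3 * tq) * (1 - 3 * tq).
Proof. by rewrite !(rmorph_nat, rmorph1, rmorphM, rmorphB) /= subst_T; ring. Qed.

Lemma size_lin (c d : int) : (size (c%:P + d *: 'X)%R <= 2)%N.
Proof.
apply: leq_trans (size_polyD _ _) _; rewrite geq_max.
rewrite (leq_trans (size_polyC_leq1 _)) //.
by rewrite (leq_trans (size_scale_leq _ _)) // size_polyX.
Qed.
Lemma ev_lin s c d : ev s (c%:P + d *: 'X) = c%:~R + d%:~R * s.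
Proof. by rewrite rmorphD /= evC evZ evX. Qed.

Lemma size_mul_exp (Q A : {poly int}) e m : (size Q <= m)%N -> (size A <= 2)%N ->
  (size (Q * A ^+ e)%R <= m + e)%N.
Proof.
move=> sQ sA; apply: leq_trans (size_polyMleq _ _) _.
have := size_poly_exp_leq A e.
have : ((size A).-1 * e <= 1 * e)%N by rewrite leq_mul2r; lia.
move: (size (A ^+ e)); lia.
Qed.

(* The bound on [size Q] says that L / g vanishes at t = oo, the cusp over xi = 0;
   this is what produces the factor xi on the right. *)
Lemma fpsU_step n r (L g : S) (Q : {poly int}) : (0 < r)%N -> (size Q <= n.*2 + r.*2)%N ->
  (1 - 3 * tq) ^+ n.*2 * (1 + tq) ^+ r.*2 * L = V g * ev tq Q ->
  exists N, (9 - 8 * xi) ^+ n.*2 * fpsU L = g * xi * ev xi N.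
Proof.
move=> r0 sQ e.
(* Multiplying by (1 + 3 t)^(2n) (1 - t)^(2r) turns the denominator into V of (1 - 9 T)^(2n) (1 -
   T)^(2r). *)
pose Q2 := Q * (1%:P + 3 *: 'X) ^+ n.*2 * (1%:P + (-1) *: 'X) ^+ r.*2.
have sQ2 : (size Q2 <= (n.*2 + r.*2).*2)%N.
  have := size_mul_exp r.*2 (size_mul_exp n.*2 sQ (size_lin 1 3)) (size_lin 1 (-1)).
  by rewrite -/Q2; lia.
have [Q' sQ' eQ'] := fpsU_ev g sQ2.
have eL : V ((1 - 9 * Tq) ^+ n.*2 * (1 - Tq) ^+ r.*2) * L = V g * ev tq Q2.
  rewrite rmorphM !rmorphXn /= subst_9T subst_1T /Q2 2!rmorphM !rmorphXn /= !ev_lin.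
  have -> : 1%:~R + 3%:~R * tq = 1 + 3 * tq by ring.
  have -> : 1%:~R + (-1)%:~R * tq = 1 - tq by ring.
  by rewrite !mulrA -e !exprMn; ring.
have := congr1 fpsU eL; rewrite fpsU_substM eQ' => eU.
(* As Q' has degree at most K = 2n + 2r - 1, the power xi^K already makes Q'(T) a polynomial in xi,
   by xi T = xi - 1. One factor xi is left over. *)
have K0 : (n.*2 + r.*2 = (n.*2 + r.*2).-1.+1)%N by lia.
set K := (n.*2 + r.*2).-1 in K0.
exists (homog K ('X - 1) 'X Q').
rewrite (@ev_homog _ _ _ _ _ xi Tq) ?evX //; last 2 first.
- by rewrite -K0.
- by rewrite rmorphB rmorph1 /= evX xi_T.
transitivity (xi ^+ (n.*2 + r.*2) * ((1 - 9 * Tq) ^+ n.*2 * (1 - Tq) ^+ r.*2 * fpsU L)).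
  have h1 : xi ^+ r.*2 * (1 - Tq) ^+ r.*2 = 1 by rewrite -exprMn xi_1T expr1n.
  transitivity (xi ^+ n.*2 * (1 - 9 * Tq) ^+ n.*2 * fpsU L *
    (xi ^+ r.*2 * (1 - Tq) ^+ r.*2)); first by rewrite h1 mulr1 -xi_9T exprMn.
  by rewrite exprD; ring.
by rewrite eU K0 exprS; ring.
Qed.

(** Odd and even refer to k in U^k D; denominators of the two modules are cleared. *)
Definition odd_form (L : S) := exists n N, (9 - 8 * xi) ^+ n * L = uq ^+ 2 * ev xi N.
Definition even_form (L : S) := exists n N, (9 - 8 * xi) ^+ n * xi * L = uq ^+ 4 * ev xi N.

Lemma xi_9 : (9 - 8 * xi) * (1 + tq) ^+ 2 = (1 - 3 * tq) ^+ 2.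
Proof.
transitivity (9 * (1 + tq) ^+ 2 - 8 * (xi * (1 + tq) ^+ 2)); first by ring.
by rewrite xi_a; ring.
Qed.

Lemma ev_xi_t (N : {poly int}) : exists2 N' : {poly int}, (size N' <= (2 * size N).+1)%N &
  (1 + tq) ^+ (2 * size N) * ev xi N = ev tq N'.
Proof.
exists (homog (size N) (1%:P + 3 *: 'X) ((1%:P + 1 *: 'X) ^+ 2) N).
  apply: size_homog; first exact: leq_trans (size_lin _ _) _.
  have := size_poly_exp_leq (1%:P + 1 *: 'X : {poly int}) 2.
  have := size_lin 1 1; move: (size _) (size _); lia.
rewrite (@ev_homog _ _ _ _ _ ((1 + tq) ^+ 2) xi) // -?exprM //.
- by rewrite mulrC xi_a ev_lin; ring.
- by rewrite rmorphXn /= ev_lin; ring.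
Qed.

(** By V s = u (1 + t), the factor u^2 becomes V of g = s^2, and 9 - 8 xi is the square of (1 - 3
    t)/(1 + t). The xi from [fpsU_step] and the xi in [even_form] turn s^2 into u^4. *)
Lemma odd_form_step L : odd_form L -> even_form (fpsU L).
Proof.
move=> [n [N e]]; have [N' sN' eN'] := ev_xi_t N.
have [] := @fpsU_step n (size N).+1 L (sq ^+ 2) (N' * (1%:P + 1 *: 'X) ^+ n.*2) => //.
- by apply: leq_trans (size_mul_exp _ sN' (size_lin 1 1)) _; lia.
- rewrite rmorphXn rmorphM !rmorphXn /= ev_lin -eN' subst_s_u.
  have -> : 1%:~R + 1%:~R * tq = 1 + tq by ring.
  have -> : (size N).+1.*2 = (2 * size N + 2)%N by lia.
  rewrite -mul2n !exprM -xi_9 exprMn.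
  have -> : (1 + tq) ^+ (2 * size N + 2) = ((1 + tq) ^+ 2) ^+ size N * (1 + tq) ^+ 2.
    by rewrite exprD exprM.
  transitivity (((1 + tq) ^+ 2) ^+ n * ((1 + tq) ^+ 2) ^+ size N *
    (1 + tq) ^+ 2 * ((9 - 8 * xi) ^+ n * L)).
    by ring.
  by rewrite e; ring.
move=> N1 e1; exists n.*2, N1.
have -> : uq ^+ 4 = (sq * xi) ^+ 2 by rewrite s_xi -exprM.
transitivity ((9 - 8 * xi) ^+ n.*2 * fpsU L * xi); first by ring.
by rewrite e1; ring.
Qed.

(** Here u^4 (1 + t)^4 = V s (1 + 3 t)(1 - 3 t), so g = s, and 1 + 3 t absorbs the denominator xi =
    (1 + 3 t)/(1 + t)^2. The xi from [fpsU_step] turns s into u^2. *)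
Lemma even_form_step L : even_form L -> odd_form (fpsU L).
Proof.
move=> [n [N e]]; have [N' sN' eN'] := ev_xi_t N.
have [] := @fpsU_step n (size N).+1 L sq
  (N' * (1%:P + 1 *: 'X) ^+ n.*2 * (1%:P + (-3) *: 'X) ^+ 1) => //.
- apply: leq_trans (size_mul_exp _ (size_mul_exp _ sN' (size_lin 1 1)) (size_lin 1 (-3))) _.
  by lia.
- have t3 : 1 + 3 * tq != 0 by rewrite -cqE cq_neq0.
  apply: (mulfI t3).
  rewrite 2!rmorphM !rmorphXn /= !ev_lin -eN'.
  have -> : 1%:~R + 1%:~R * tq = 1 + tq by ring.
  have -> : (size N).+1.*2 = (2 * size N + 2)%N by lia.
  rewrite -mul2n !exprM -xi_9 exprMn.
  have -> : (1 + tq) ^+ (2 * size N + 2) = ((1 + tq) ^+ 2) ^+ size N * (1 + tq) ^+ 2.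
    by rewrite exprD exprM.
  rewrite -{1}xi_a.
  transitivity (((1 + tq) ^+ 2) ^+ n * ((1 + tq) ^+ 2) ^+ size N *
    (1 + tq) ^+ 4 * ((9 - 8 * xi) ^+ n * xi * L)).
    by ring.
  rewrite e.
  transitivity (((1 + tq) ^+ 2) ^+ n * ((1 + tq) ^+ 2) ^+ size N *
    ev xi N * (uq * (1 + tq)) ^+ 4); first by ring.
  have -> : (uq * (1 + tq)) ^+ 4 = V sq * V sq ^+ 3 by rewrite subst_s_u; ring.
  by rewrite subst_s3; ring.
move=> N1 e1; exists n.*2, N1; rewrite e1 s_xi; ring.
Qed.

Definition pdo_iter k := iter k fpsU pdo.

(** Multiplying D^2 (1 - 3 t) = V u (1 - t) by 1 + 3 t makes the left coefficient even; the even
    part of (1 + 3 t)(1 - t) is 1 - 3 t^2. *)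
Lemma pdo_iter2 : (9 - 8 * xi) * pdo_iter 2 = uq * (3 - 2 * xi).
Proof.
have e : V (1 - 9 * Tq) * pdo ^+ 2 = V (uq * (1 - 3 * Tq)) + V uq * (2 * tq).
  rewrite subst_9T rmorphM rmorphB !(rmorph_nat, rmorph1, rmorphM) /= subst_T.
  transitivity ((1 + 3 * tq) * (pdo ^+ 2 * (1 - 3 * tq))); first by ring.
  by rewrite pdo2E; ring.
have U2 : fpsU (2 * tq) = 0.
  by apply: fpsU_odd; rewrite rmorphM rmorph_nat /= sg_t mulrN.
have := congr1 fpsU e; rewrite fpsUD fpsU_subst !fpsU_substM U2 mulr0 addr0 => eU.
rewrite /pdo_iter /= fpsU_pdo -xi_9T -mulrA eU.
transitivity (uq * (xi - 3 * (xi * Tq))); first by ring.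
by rewrite xi_T; ring.
Qed.

Lemma pdo_iter3 : odd_form (pdo_iter 3).
Proof.
(* The second iterate carries u rather than u^2, so this step is separate, with g = s. The numerator
   of 3 - 2 xi is 3 (1 + t)^2 - 2 (1 + 3 t) = 1 + 3 t^2. *)
pose Q : {poly int} := (1%:P + 3 *: 'X^2) * (1%:P + 1 *: 'X) ^+ 1.
have [] := @fpsU_step 1 1 (pdo_iter 2) sq Q => //.
- rewrite -[(1.*2 + 1.*2)%N]/(3 + 1)%N; apply: size_mul_exp; last exact: size_lin.
  apply: leq_trans (size_polyD _ _) _; rewrite geq_max.
  rewrite (leq_trans (size_polyC_leq1 _)) //.
  by rewrite (leq_trans (size_scale_leq _ _)) // size_polyXn.
- rewrite /Q rmorphM rmorphXn rmorphD /= ev_lin evC evZ rmorphXn /= evX.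
  have -> : 1%:~R + 1%:~R * tq = 1 + tq by ring.
  rewrite -[(1 - 3 * tq) ^+ 1.*2]xi_9 subst_s_u.
  rewrite -[fpsU (fpsU pdo)]/(pdo_iter 2).
  transitivity ((1 + tq) ^+ 4 * ((9 - 8 * xi) * pdo_iter 2)).
    by rewrite -[1.*2]/2%N; ring.
  rewrite pdo_iter2.
  transitivity (uq * (1 + tq) ^+ 2 * (3 * (1 + tq) ^+ 2 - 2 * (xi * (1 + tq) ^+ 2))); first by ring.
  by rewrite xi_a; ring.
by move=> N e; exists 2, N; rewrite e s_xi.
Qed.

Lemma pdo_iter_form k : odd_form (pdo_iter k.*2.+3) /\ even_form (pdo_iter k.*2.+4).
Proof.
elim: k => [|k [_ IH]]; first by split; [|apply: odd_form_step]; apply: pdo_iter3.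
have h : odd_form (pdo_iter k.+1.*2.+3) by apply: even_form_step IH.
by split=> //; apply: odd_form_step h.
Qed.

Lemma odd_formB L L' : odd_form L -> odd_form L' -> odd_form (L - L').
Proof.
move=> [n [N e]] [n' [N' e']]; pose A : {poly int} := 9%:P + (-8) *: 'X.
have eA : ev xi A = 9 - 8 * xi by rewrite ev_lin; ring.
exists (n + n')%N, (A ^+ n' * N - A ^+ n * N').
rewrite rmorphB !rmorphM !rmorphXn /= eA exprD.
transitivity ((9 - 8 * xi) ^+ n' * ((9 - 8 * xi) ^+ n * L) -
   (9 - 8 * xi) ^+ n * ((9 - 8 * xi) ^+ n' * L')); first by ring.
by rewrite e e'; ring.
Qed.

Lemma even_formB L L' : even_form L -> even_form L' -> even_form (L - L').
Proof.
move=> [n [N e]] [n' [N' e']]; pose A : {poly int} := 9%:P + (-8) *: 'X.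
have eA : ev xi A = 9 - 8 * xi by rewrite ev_lin; ring.
exists (n + n')%N, (A ^+ n' * N - A ^+ n * N').
rewrite rmorphB !rmorphM !rmorphXn /= eA exprD.
transitivity ((9 - 8 * xi) ^+ n' * ((9 - 8 * xi) ^+ n * xi * L) -
   (9 - 8 * xi) ^+ n * ((9 - 8 * xi) ^+ n' * xi * L')); first by ring.
by rewrite e e'; ring.
Qed.

(** Split off the root 1 of Q: xi - 1 = xi T is nonzero, and the cofactor at xi has as constant term
    its nonzero value at 1. Identities in Z[xi] thus lift to polynomials. *)
Lemma ev_xi_inj : injective (ev xi).
Proof.
apply: raddf_inj => Q e; apply/eqP/contraT => Q0.
have [m [q /implyP nq eQ]] := multiplicity_XsubC Q 1.
have {}e : ev xi Q = 0 by exact: e.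
move: e; rewrite eQ rmorphM rmorphXn rmorphB /= evX evC -xi_T.
have xT : xi * Tq != 0.
  rewrite mulf_neq0 //; first by apply: fps_const_neq0; rewrite const_xi.
  apply: contra_neq (expf_neq0 2 tq_neq0) => T0.
  by rewrite -subst_T T0 rmorph0.
move/eqP; rewrite mulf_eq0 (negbTE (expf_neq0 _ xT)) orbF => /eqP e.
have := congr1 (@fps_const int) e; rewrite const_ev rmorph0 const_xi => /eqP.
by have := nq Q0; rewrite /root => /negbTE ->.
Qed.

(** Applied with B a power of 9 - 8 X: such a denominator does not change the order of vanishing at
    xi = 0. *)
Lemma coef_low_mul (B P N : {poly int}) m : B`_0 != 0 -> B * P = 'X^m * N ->
  forall i, (i < m)%N -> P`_i = 0.
Proof.
move=> B0 e i; elim/ltn_ind: i => i IH lt.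
have := congr1 (fun p : {poly int} => p`_i) e; rewrite coefXnM lt coefM big_ord_recl subn0.
rewrite big1 => [|j _]; last by rewrite lift0 IH ?mulr0 //; move: (ltn_ord j); lia.
by move/eqP; rewrite addr0 mulf_eq0 (negbTE B0) => /eqP.
Qed.

(** * Link with the given definitions, and the count of powers of xi *)

Lemma smulE (f g : S) : smul f g = f * g. Proof. by []. Qed.
Lemma spowE (f : S) n : spow f n = f ^+ n.
Proof.
elim: n => [|n IH]; first by apply: fpsP => n; rewrite expr0 fps1.
by rewrite exprS -IH.
Qed.
Lemma etaE_eulerE a : etaE a = E a. Proof. by []. Qed.
Lemma etaEinv_eulerEinv a : etaEinv a = I a. Proof. by []. Qed.
Definition defsE := (smulE, spowE, etaE_eulerE, etaEinv_eulerEinv).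

Lemma gammaqE : gammaq = uq ^+ 5 :> S.
Proof. by rewrite /gammaq !defsE uq.unlock; ring. Qed.
Lemma xiqE : xiq = xi. Proof. by rewrite /xiq !defsE xi.unlock. Qed.
Lemma pdo_iterE k n : pdo_iter k n = PDO (2 ^ k * n).
Proof.
have e : PDOgf = pdo by rewrite /PDOgf !defsE pdo.unlock.
elim: k n => [|k IH] n; first by rewrite mul1n /PDO e.
by rewrite /pdo_iter iterS /fpsU -/(pdo_iter k) IH expnSr -mulnA.
Qed.

Lemma PhiE k : Phi k = uq ^+ (5 * 2 ^ k) * (pdo_iter (k + 2) - pdo_iter k).
Proof.
rewrite /Phi !defsE gammaqE -exprM.
suff -> : pdo_iter (k + 2) - pdo_iter k =
  ssub (fun n => PDO (2 ^ (k + 2) * n)) (fun n => PDO (2 ^ k * n)) by [].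
by apply: fpsP => n; rewrite fpsB !pdo_iterE.
Qed.

Lemma poly_in_xiE P : poly_in_xi P = ev xi P.
Proof.
apply: fpsP => n; rewrite /poly_in_xi (ev_wide _ (leqnn _)) fps_sum.
apply: eq_bigr => i _; rewrite xiqE spowE.
by rewrite -(rmorph_int (@fps_scal int)) intz fps_scalM.
Qed.

(** gamma^(2^k) and [odd_form] together contribute u^(5 2^k + 2) = u^(6m) = xi^(2m) (9 - 8 xi)^m. *)
Lemma tau_odd j : exists m, (5 * 2 ^ j.*2.+3 + 2 = 6 * m)%N /\ tau j.*2.+3 = (2 * m)%N.
Proof.
have [w ew] : exists w, (4 ^ j = 3 * w + 1)%N.
  by elim: j => [|j [w IH]]; [exists 0%N | exists (4 * w + 1)%N; rewrite expnS IH; lia].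
have e2 : (2 ^ j.*2 = 3 * w + 1)%N by rewrite -ew -mul2n expnM.
exists (20 * w + 7)%N; rewrite !expnS e2; split; first by lia.
have -> : tau j.*2.+3 = (7 * 2 ^ (2 * j.+2 - 3) - (2 * (4 ^ (j.+2 - 2) - 1)) %/ 3)%N.
  have o : odd j.*2.+3 by lia.
  have h : j.*2.+4./2 = j.+2 by lia.
  by rewrite /tau o h.
have -> : (2 * j.+2 - 3 = j.*2.+1)%N by lia.
have -> : (j.+2 - 2 = j)%N by lia.
by rewrite expnS e2 ew addnK (mulnCA 2 3 w) mulKn //; lia.
Qed.

(** Here the module contributes u^4 / xi, so one power is lost from xi^(2m). *)
Lemma tau_even j :
  exists m, (5 * 2 ^ j.*2.+4 + 4 = 6 * m)%N /\ (tau j.*2.+4).+1 = (2 * m)%N.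
Proof.
have [w ew] : exists w, (4 ^ j = 3 * w + 1)%N.
  by elim: j => [|j [w IH]]; [exists 0%N | exists (4 * w + 1)%N; rewrite expnS IH; lia].
have e2 : (2 ^ j.*2 = 3 * w + 1)%N by rewrite -ew -mul2n expnM.
exists (40 * w + 14)%N; rewrite !expnS e2; split; first by lia.
have -> : tau j.*2.+4 = (7 * 2 ^ (2 * j.+2 - 2) - (4 ^ (j.+2 - 1) - 1) %/ 3)%N.
  have o : odd j.*2.+4 = false by lia.
  have h : j.*2.+4./2 = j.+2 by lia.
  by rewrite /tau o h.
have -> : (2 * j.+2 - 2 = j.*2.+2)%N by lia.
have -> : (j.+2 - 1 = j.+1)%N by lia.
rewrite !expnS e2 ew; have -> : (4 * (3 * w + 1) - 1 = 3 * (4 * w + 1))%N by lia.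
rewrite mulKn //; lia.
Qed.

Theorem theorem5p2 (k : nat) (P : {poly int}) :
  (3 <= k)%N ->
  (forall n : nat, Phi k n = poly_in_xi P n) ->
  forall m : nat, (m < tau k)%N -> P`_m = 0.
Proof.
move=> k3 /fpsP; rewrite PhiE poly_in_xiE => eP.
pose A : {poly int} := 9%:P + (-8) *: 'X.
have eA : ev xi A = 9 - 8 * xi by rewrite ev_lin; ring.
have A0 n : (A ^+ n)`_0 != 0.
  have -> : (A ^+ n)`_0 = 9 ^+ n.
    by rewrite -horner_coef0 horner_exp hornerD hornerC hornerZ hornerX mulr0 addr0.
  by rewrite expf_neq0.
have [j kj] : exists j, k = j.*2.+3 \/ k = j.*2.+4.
  by exists (k - 3)./2; lia.
have [oform eform] := pdo_iter_form j; have [oform' eform'] := pdo_iter_form j.+1.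
case: kj => kj; rewrite kj in eP *.
  (* k and k + 2 have the same parity, so both iterates lie in one module. *)
  have [n [N e]] := odd_formB oform' oform.
  have [l [el ->]] := tau_odd j.
  apply: (@coef_low_mul (A ^+ n) _ (A ^+ l * N)) => //.
  apply: ev_xi_inj; rewrite !rmorphM !rmorphXn /= eA evX -eP.
  rewrite addn2.
  transitivity (uq ^+ (5 * 2 ^ j.*2.+3) *
    ((9 - 8 * xi) ^+ n * (pdo_iter j.*2.+3.+2 - pdo_iter j.*2.+3))); first by ring.
  rewrite e mulrA -exprD el.
  by rewrite exprM u6 exprMn -exprM; ring.
have [n [N e]] := even_formB eform' eform.
have [l [el etau]] := tau_even j.
(* The xi of [even_form] stays on the left as ['X * P], which shifts the coefficient index by one
   and matches [tau] plus one. *)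
move=> m lt; have := @coef_low_mul (A ^+ n) ('X * P) (A ^+ l * N) (2 * l) (A0 n) _ m.+1.
rewrite coefXM /=; apply; last by rewrite -etau.
apply: ev_xi_inj; rewrite !rmorphM !rmorphXn /= eA evX -eP.
rewrite addn2.
transitivity (uq ^+ (5 * 2 ^ j.*2.+4) *
  ((9 - 8 * xi) ^+ n * xi * (pdo_iter j.*2.+4.+2 - pdo_iter j.*2.+4))).
  by ring.
by rewrite e mulrA -exprD el exprM u6 exprMn -exprM; ring.
Qed.
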